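(* Work in type $A_4$. Let $\mathbf{i}$ be a reduced expression for $w_0$ and let $\mathcal{P}(\mathbf{i})$ be the set of $6$ partial quivers obtained from $\mathbf{i}$ via its chamber sets. Consider the $10$ vectors $v_P$ ($P\in\mathcal{P}(\mathbf{i})$) and $v_j$ ($j=1,2,3,4$) in $\mathbb{R}^{10}$. For each vector in this set of $10$, consider the set of the $9$ remaining vectors. Then there is a unique hyperplane $W\in\mathcal{W}$ such that these $9$ vectors lie on $W$. Moreover, the set of $10$ elements of $\mathcal{W}$ obtained in this way is the set of the $10$ boundary walls of a simplicial region $X_{\mathbf{i}}$, and the original $10$ vectors $v_P$ ($P\in\mathcal{P}(\mathbf{i})$), $v_j$ ($j=1,2,3,4$) all lie in $X_{\mathbf{i}}$. Also, the map $\mathbf{i}\mapsto X_{\mathbf{i}}$ gives a bijection between commutation classes of reduced expressions for $w_0$ and simplicial regions.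
   Context: **Weyl group.** $W=S_5$ is the Weyl group of type $A_4$, with Coxeter generators $s_p=(p\ p{+}1)$, $p=1,\dots,4$, and longest element $w_0$ (length $10$). A reduced expression $\mathbf{i}=(i_1,\dots,i_{10})$ is identified with $s_{i_1}\cdots s_{i_{10}}=w_0$. Two reduced expressions are in the same commutation class if one is obtained from the other by a sequence of commutations $s_ps_q=s_qs_p$, $|p-q|>1$. **Chamber sets.** For each pair $s<s'$ of positions of consecutive occurrences of a letter $p$ in $\mathbf{i}$ (i.e. $i_s=i_{s'}=p$ and $i_r\ne p$ for $s<r<s'$) there is a bounded chamber in the chamber diagram (pseudo-line arrangement) of $\mathbf{i}$; its chamber set is the set of labels of strings passing below it, namely $\{s_{i_1}s_{i_2}\cdots s_{i_s}(m): p<m\le 5\}$. There are $6$ bounded chambers. **Partial quivers.** A partial quiver $P$ of type $A_4$ is a word of length $3$ in the symbols $L,R,-$ (edges of the Dynkin diagram from left to right, numbered $4,3,2$; $-$ means undirected) in which the directed edges form a nonempty connected string. Put $l_1(P)=\{j: \text{edge } j \text{ is } L\}$; $l_2(P)=[1,i-1]$ if the rightmost directed edge is an $R$ at edge $i$, else $\emptyset$; $l_3(P)=[j+1,5]$ if the leftmost directed edge is an $R$ at edge $j$, else $\emptyset$; and $l(P)=l_1(P)\cup l_2(P)\cup l_3(P)$. The map $l$ is a bijection from partial quivers to all chamber sets. $\mathcal{P}(\mathbf{i})$ is the set of the $6$ partial quivers $P$ such that $l(P)$ is a chamber set of $\mathbf{i}$. **Vectors** ($P$; $l(P)$; $v_P$):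 $LLL$; $234$; $(1,0,0,0,0,0,0,0,0,0)$. $LLR$; $134$; $(0,0,1,0,0,0,0,0,1,0)$. $LRL$; $24$; $(1,1,0,0,0,0,1,1,0,0)$. $RLL$; $235$; $(1,0,0,1,0,0,0,0,0,1)$. $LRR$; $14$; $(0,1,0,0,0,0,0,1,1,0)$. $RLR$; $135$; $(0,0,1,1,0,0,0,0,1,1)$. $RRL$; $25$; $(1,0,0,0,0,0,1,0,0,0)$. $RRR$; $15$; $(0,0,0,0,0,0,0,0,1,0)$. $LL-$; $34$; $(0,0,0,0,0,0,0,1,0,0)$. $LR-$; $124$; $(0,1,0,0,0,1,0,0,0,0)$. $RL-$; $35$; $(0,0,0,0,0,1,0,0,0,1)$. $RR-$; $125$; $(0,0,0,1,0,0,0,0,0,0)$. $-LL$; $23$; $(1,0,0,0,0,0,0,0,0,1)$. $-LR$; $13$; $(0,0,1,0,0,0,0,0,1,1)$. $-RL$; $245$; $(1,1,0,0,0,0,1,0,0,0)$. $-RR$; $145$; $(0,1,0,0,0,0,0,0,1,0)$. $L--$; $4$; $(0,1,0,0,0,0,0,1,0,0)$. $R--$; $1235$; $(0,0,0,1,0,0,0,0,0,1)$. $-L-$; $3$; $(0,0,1,0,0,0,0,0,0,1)$. $-R-$; $1245$; $(0,1,0,0,0,0,1,0,0,0)$. $--L$; $2$; $(1,0,0,0,1,0,0,0,0,0)$. $--R$; $1345$; $(0,0,0,0,1,0,0,0,1,0)$. Also $v_1=(1,0,0,0,1,0,0,0,1,0)$, $v_2=(0,0,1,0,0,0,1,0,0,0)$,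 $v_3=(0,1,0,0,0,1,0,0,0,1)$, $v_4=(0,0,0,1,0,0,0,1,0,0)$. **The function $R$ and simplicial regions.** Let $\mathbf{j}=(1,3,2,4,1,3,2,4,1,3)$ and $\mathbf{j}'=(2,4,1,3,2,4,1,3,2,4)$. Lusztig's piecewise-linear function $R=R_{\mathbf{j}}^{\mathbf{j}'}:\mathbb{R}^{10}\to\mathbb{R}^{10}$ is obtained by choosing a sequence of reduced expressions from $\mathbf{j}$ to $\mathbf{j}'$ in which consecutive ones differ by a braid relation and composing the corresponding maps (the result is independent of the choice): when $s_ps_q$ is replaced by $s_qs_p$ ($|p-q|>1$), the corresponding consecutive coordinates $(a,b)$ become $(b,a)$; when $s_ps_qs_p$ is replaced by $s_qs_ps_q$ ($|p-q|=1$), the corresponding consecutive coordinates $(a,b,c)$ become $(b+c-a,a,b)$ if $a\le c$ and $(b,c,b+a-c)$ if $a\ge c$. A region of linearity of $R$ is a set of the form: closure of the interior of $\{v: R(v)=\Lambda(v)\}$, where $\Lambda$ is a linear map for which this interior is nonempty; each region of linearity is a convex polyhedral cone. The minimum number of linear inequalities needed to define a region of linearity in $\mathbb{R}^{10}$ is $6$. A simplicial region is a set $X\cap\mathbb{R}_{\ge0}^{10}$, where $X$ is a region of linearity of $R$ defined by exactly $6$ irredundant linear inequalities. Each simplicial region has exactly $10$ walls (the hyperplanes in $\mathbb{R}^{10}$ spanned by its facets). $\mathcal{W}$ is the set of all hyperplanes in $\mathbb{R}^{10}$ which arise as walls of simplicial regions. *)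

(* Defs.v *)
From HB Require Import structures.
From Stdlib Require Import Relation_Operators.
From mathcomp Require Import all_boot all_order all_algebra fingroup perm.
From mathcomp Require Import classical_sets cardinality reals topology.
From mathcomp Require Import normedtype.
Set Implicit Arguments.
Unset Strict Implicit.
Unset Printing Implicit Defensive.
Import Order.TTheory GRing.Theory Num.Theory.
Import numFieldNormedType.Exports.

(* The Weyl group is 'S_5.  A string m = 1, ..., 5 is the ordinal of value
   m - 1, so that [label] recovers m; the letters of words are 1, ..., 4. *)

Definition label (m : 'I_5) : nat := m.+1.

Definition sgen (p : nat) : 'S_5 := tperm (inord p.-1) (inord p).

(* [s * t] in 'S_5 applies s first, hence the reversal: [word_perm w m] is
   s_{i_1}(s_{i_2}( ... m)). *)
Definition word_perm (w : seq nat) : 'S_5 := (\prod_(p <- rev w) sgen p)%g.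

Definition w0 : 'S_5 := perm (@rev_ord_inj 5).

(* w0 has length 10, so an expression with 10 letters is reduced. *)
Definition reduced_w0 (w : seq nat) : bool :=
  [&& size w == 10, all (fun p => 0 < p < 5) w & word_perm w == w0].

Definition far (p q : nat) : bool := (p.+1 < q) || (q.+1 < p).
Definition adjacent (p q : nat) : bool := (p.+1 == q) || (q.+1 == p).

Definition commutation_step (w w' : seq nat) : Prop :=
  exists u v p q,
    [/\ far p q, w = u ++ [:: p; q] ++ v & w' = u ++ [:: q; p] ++ v].

(* The converse of a commutation step is a commutation step, so this is an
   equivalence relation. *)
Definition same_commutation_class : seq nat -> seq nat -> Prop :=
  clos_refl_trans (seq nat) commutation_step.

(* Positions in words are counted from 0, unlike i_1, ..., i_10. *)
Definition consecutive (w : seq nat) (s s' : 'I_10) : bool :=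
  [&& s < s', nth 0 w s == nth 0 w s'
    & [forall r : 'I_10, (s < r < s') ==> (nth 0 w r != nth 0 w s)]].

Definition chamber_set (w : seq nat) (s : 'I_10) : {set 'I_5} :=
  [set word_perm (take s.+1 w) m | m : 'I_5 & nth 0 w s < label m].

Definition chamber_sets (w : seq nat) : {set {set 'I_5}} :=
  [set chamber_set w s | s : 'I_10 & [exists s', consecutive w s s']].

Inductive symbol := L | R | U.

Definition is_L e := if e is L then true else false.
Definition is_R e := if e is R then true else false.
Definition directed e := ~~ (if e is U then true else false).

(* The symbols on edges 4, 3, 2, in this order. *)
Definition word3 := (symbol * symbol * symbol)%type.

Definition partial_quiver (P : word3) : bool :=
  let: (a, b, c) := P in
  [|| directed a, directed b | directed c]
  && (directed a && directed c ==> directed b).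

Definition edges (P : word3) : seq (nat * symbol) :=
  let: (a, b, c) := P in [:: (4, a); (3, b); (2, c)].

Definition directed_edges (P : word3) : seq (nat * symbol) :=
  [seq e <- edges P | directed e.2].

Definition l1 (P : word3) : {set 'I_5} :=
  [set m | has (fun e => (e.1 == label m) && is_L e.2) (edges P)].

Definition l2 (P : word3) : {set 'I_5} :=
  let: (i, e) := last (0, U) (directed_edges P) in
  if is_R e then [set m | label m <= i.-1] else finset.set0.

Definition l3 (P : word3) : {set 'I_5} :=
  let: (j, e) := head (0, U) (directed_edges P) in
  if is_R e then [set m | j.+1 <= label m] else finset.set0.

Definition l (P : word3) : {set 'I_5} := l1 P :|: l2 P :|: l3 P.

Definition quivers_of (w : seq nat) (P : word3) : Prop :=
  partial_quiver P /\ l P \in chamber_sets w.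

Local Open Scope ring_scope.

Definition vec (K : realType) (s : seq nat) : 'rV[K]_10 :=
  \row_k (nth 0%N s k)%:R.

(* The words that are not partial quivers, in the last line, get a junk
   value. *)
Definition v_quiver (K : realType) (P : word3) : 'rV[K]_10 :=
  match P with
  | (L, L, L) => vec K [:: 1; 0; 0; 0; 0; 0; 0; 0; 0; 0]%N
  | (L, L, R) => vec K [:: 0; 0; 1; 0; 0; 0; 0; 0; 1; 0]%N
  | (L, R, L) => vec K [:: 1; 1; 0; 0; 0; 0; 1; 1; 0; 0]%N
  | (R, L, L) => vec K [:: 1; 0; 0; 1; 0; 0; 0; 0; 0; 1]%N
  | (L, R, R) => vec K [:: 0; 1; 0; 0; 0; 0; 0; 1; 1; 0]%N
  | (R, L, R) => vec K [:: 0; 0; 1; 1; 0; 0; 0; 0; 1; 1]%N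
  | (R, R, L) => vec K [:: 1; 0; 0; 0; 0; 0; 1; 0; 0; 0]%N
  | (R, R, R) => vec K [:: 0; 0; 0; 0; 0; 0; 0; 0; 1; 0]%N
  | (L, L, U) => vec K [:: 0; 0; 0; 0; 0; 0; 0; 1; 0; 0]%N
  | (L, R, U) => vec K [:: 0; 1; 0; 0; 0; 1; 0; 0; 0; 0]%N
  | (R, L, U) => vec K [:: 0; 0; 0; 0; 0; 1; 0; 0; 0; 1]%N
  | (R, R, U) => vec K [:: 0; 0; 0; 1; 0; 0; 0; 0; 0; 0]%N
  | (U, L, L) => vec K [:: 1; 0; 0; 0; 0; 0; 0; 0; 0; 1]%N
  | (U, L, R) => vec K [:: 0; 0; 1; 0; 0; 0; 0; 0; 1; 1]%N
  | (U, R, L) => vec K [:: 1; 1; 0; 0; 0; 0; 1; 0; 0; 0]%N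
  | (U, R, R) => vec K [:: 0; 1; 0; 0; 0; 0; 0; 0; 1; 0]%N
  | (L, U, U) => vec K [:: 0; 1; 0; 0; 0; 0; 0; 1; 0; 0]%N
  | (R, U, U) => vec K [:: 0; 0; 0; 1; 0; 0; 0; 0; 0; 1]%N
  | (U, L, U) => vec K [:: 0; 0; 1; 0; 0; 0; 0; 0; 0; 1]%N
  | (U, R, U) => vec K [:: 0; 1; 0; 0; 0; 0; 1; 0; 0; 0]%N
  | (U, U, L) => vec K [:: 1; 0; 0; 0; 1; 0; 0; 0; 0; 0]%N
  | (U, U, R) => vec K [:: 0; 0; 0; 0; 1; 0; 0; 0; 1; 0]%N
  | (U, U, U) | (L, U, L) | (L, U, R) | (R, U, L) | (R, U, R) => 0
  end.

Definition v_common (K : realType) : seq 'rV[K]_10 :=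
  [:: vec K [:: 1; 0; 0; 0; 1; 0; 0; 0; 1; 0]%N;
      vec K [:: 0; 0; 1; 0; 0; 0; 1; 0; 0; 0]%N;
      vec K [:: 0; 1; 0; 0; 0; 1; 0; 0; 0; 1]%N;
      vec K [:: 0; 0; 0; 1; 0; 0; 0; 1; 0; 0]%N].

(* Braid relations at position k (counted from 0) of a word: the pair of
   letters p q is exchanged if [far p q]; otherwise p q p becomes q p q. *)
Definition can_move (w : seq nat) (k : nat) : bool :=
  let: p := nth 0%N w k in let: q := nth 0%N w k.+1 in
  if far p q then (k.+2 <= size w)%N
  else [&& adjacent p q, nth 0%N w k.+2 == p & (k.+3 <= size w)%N].

Definition move_word (w : seq nat) (k : nat) : seq nat :=
  let: p := nth 0%N w k in let: q := nth 0%N w k.+1 in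
  if far p q then take k w ++ [:: q; p] ++ drop k.+2 w
  else take k w ++ [:: q; p; q] ++ drop k.+3 w.

Definition move_coords (K : realType) (w : seq nat) (x : seq K) (k : nat) :
    seq K :=
  let: a := x`_k in let: b := x`_k.+1 in let: c := x`_k.+2 in
  if far (nth 0%N w k) (nth 0%N w k.+1)
  then take k x ++ [:: b; a] ++ drop k.+2 x
  else take k x
       ++ (if a <= c then [:: b + c - a; a; b] else [:: b; c; b + a - c])
       ++ drop k.+3 x.

Fixpoint valid_moves (w w' : seq nat) (ks : seq nat) : bool :=
  if ks is k :: ks' then can_move w k && valid_moves (move_word w k) w' ks'
  else w == w'.

Fixpoint transport (K : realType) (w : seq nat) (ks : seq nat) (x : seq K) :
    seq K :=
  if ks is k :: ks' then transport (move_word w k) ks' (move_coords w x k)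
  else x.

Definition word_j : seq nat := [:: 1; 3; 2; 4; 1; 3; 2; 4; 1; 3]%N.
Definition word_j' : seq nat := [:: 2; 4; 1; 3; 2; 4; 1; 3; 2; 4]%N.

(* One choice of a sequence of braid relations from j to j'; Lusztig's
   function does not depend on it. *)
Definition moves_j_j' : seq nat :=
  [:: 6; 4; 5; 3; 1; 3; 6; 4; 6; 7; 5; 4; 3; 2; 3; 5; 6; 0; 2; 3; 5; 6; 8; 5;
      1]%N.

Lemma moves_j_j'_valid : valid_moves word_j word_j' moves_j_j'.
Proof. by vm_compute. Qed.

Definition lusztig_R (K : realType) (v : 'rV[K]_10) : 'rV[K]_10 :=
  \row_k (transport word_j moves_j_j' [seq v 0 i | i <- enum 'I_10])`_k.

Local Open Scope classical_set_scope.

Definition region_of_linearity (K : realType) (X : set 'rV[K]_10) : Prop :=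
  exists f : {linear 'rV[K]_10 -> 'rV[K]_10},
    let E := [set v | lusztig_R v = f v] in
    E° !=set0 /\ X = closure E°.

(* The columns of A are the coefficients of n linear inequalities. *)
Definition defined_by (K : realType) (n : nat) (X : set 'rV[K]_10)
    (A : 'M[K]_(10, n)) : Prop :=
  X = [set v | forall k, 0 <= (v *m A) 0 k].

Definition irredundant (K : realType) (n : nat) (A : 'M[K]_(10, n)) : Prop :=
  forall k, [set v : 'rV[K]_10 | forall k', k' != k -> 0 <= (v *m A) 0 k']
            <> [set v | forall k', 0 <= (v *m A) 0 k'].

Definition nonneg_orthant (K : realType) : set 'rV[K]_10 :=
  [set v | forall k, 0 <= v 0 k].
Arguments nonneg_orthant K : clear implicits.

Definition simplicial_region (K : realType) (S : set 'rV[K]_10) : Prop :=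
  exists X : set 'rV[K]_10,
    [/\ region_of_linearity X,
        exists2 A : 'M[K]_(10, 6), defined_by X A & irredundant A
      & S = X `&` nonneg_orthant K].

Definition lie_on (K : realType) (A : set 'rV[K]_10) (H : {vspace 'rV[K]_10}) :
    Prop :=
  forall v, A v -> v \in H.

Definition is_span (K : realType) (A : set 'rV[K]_10)
    (H : {vspace 'rV[K]_10}) : Prop :=
  lie_on A H /\ forall H' : {vspace 'rV[K]_10}, lie_on A H' -> (H <= H')%VS.

Definition face (K : realType) (S F : set 'rV[K]_10) : Prop :=
  exists2 a : 'cV[K]_10, (forall v, S v -> 0 <= (v *m a) 0 0)
                       & F = S `&` [set v | (v *m a) 0 0 = 0].

(* A face of codimension 1. *)
Definition facet (K : realType) (S F : set 'rV[K]_10) : Prop :=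
  face S F /\ exists HS HF, [/\ is_span S HS, is_span F HF
                              & \dim HS = (\dim HF).+1].

Definition hyperplane (K : realType) (H : {vspace 'rV[K]_10}) : Prop :=
  \dim H = 9%N.

Definition walls (K : realType) (S : set 'rV[K]_10) : set {vspace 'rV[K]_10} :=
  [set H | hyperplane H /\ exists2 F, facet S F & is_span F H].

Definition all_walls (K : realType) : set {vspace 'rV[K]_10} :=
  [set H | exists2 S : set 'rV[K]_10, simplicial_region S & walls S H].
Arguments all_walls K : clear implicits.

Definition vectors_of (K : realType) (w : seq nat) : set 'rV[K]_10 :=
  [set v_quiver K P | P in [set P | quivers_of w P]]
  `|` [set v | v \in v_common K].
Arguments vectors_of K w : clear implicits.

(* For u in [vectors_of K w], a hyperplane in [all_walls K] containing the
   remaining vectors. *)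
Definition wall_opposite (K : realType) (w : seq nat) (u : 'rV[K]_10)
    (H : {vspace 'rV[K]_10}) : Prop :=
  all_walls K H /\ lie_on (vectors_of K w `\ u) H.

Definition walls_of (K : realType) (w : seq nat) : set {vspace 'rV[K]_10} :=
  [set H | exists2 u, vectors_of K w u & wall_opposite w u H].
Arguments walls_of K w : clear implicits.

(* Main.v *)
From HB Require Import structures.
From Stdlib Require Import ZArith Relation_Operators.
Require Import Defs.
From mathcomp Require Import all_boot all_order all_algebra fingroup perm.
From mathcomp Require Import ssrZ zify ring lra.
From mathcomp Require Import classical_sets boolp cardinality reals topology.
From mathcomp Require Import normedtype.
Set Implicit Arguments.
Unset Strict Implicit.
Unset Printing Implicit Defensive.
Import Order.TTheory GRing.Theory Num.Theory.
Import numFieldNormedType.Exports.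

(** Along a sequence of braid relations, Lusztig's function R branches at each
long braid relation on the sign of a comparison c - a, which is a linear form
in the original coordinates. There are ten long relations between the two
words, so each of the 2^10 sign patterns determines a closed cell, on which the
ten signed comparisons are nonnegative, and a linear map with which R agrees on
that cell ([lusztig_R_cell]). The comparisons are nonzero forms, and a search
that drops a branch as soon as a nonnegative combination of earlier comparisons
refutes it leaves 222 patterns. A nonempty open set contains a point off all
the zero sets, hence meets the interior of one of these cells
([open_cell_feasible]); so a region of linearity is the closure of the interior
of the set where R agrees with the linear map of one of the 222 patterns
([region_feasible]).

Of these patterns, 62 belong to the commutation classes. For such a class, let
sigma be the pattern of the sum of its ten vectors. All comparisons of the cell
of sigma vanish on v_1, ..., v_4 and are nonnegative on the six v_P; moreover
each v_P has a dual comparison, positive on it and zero on the nine other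
vectors, and each v_j has a dual coordinate in the same sense. These few signs
say everything ([dual_system]): the ten vectors form a basis whose dual basis
consists, up to scaling, of six comparisons and four coordinates; expanding a
vector in this basis shows that the cell is cut out by the six comparisons,
irredundantly ([six_inequalities]), and that the cell meets the orthant in the
cone spanned by the ten vectors ([cell_orthant_cone]). Since no other feasible
pattern has the same linear map, this cell is a region of linearity
([closure_chart_cell]). The walls of a cone spanned by a basis are the
hyperplanes through all basis vectors but one ([walls_cone]), which gives the
assertions on walls.

The remaining patterns have linear maps for which six inequalities do not
suffice ([heptad_not6]). For each one there are seven points outside the region
such that the sum of any two of them is inside. If six inequalities defined the
region, two of the seven points would violate the same inequality, and so would
their sum.

On the side of words, two words are in the same commutation class if and only
if they have the same lexicographic normal form ([same_classP]), so that the
768 reduced expressions fall into 62 classes; evaluating the chamber sets shows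
that an expression and its normal form have the same partial quivers. *)

(** * Linear forms with integer coefficients *)

(** Forms are compared, added and evaluated by computation, so their
coefficients are binary integers; they act on vectors over the real field
through [ofZ]. *)
Definition form := seq Z.

Fixpoint addf (h1 h2 : form) : form :=
  match h1, h2 with
  | a :: h1', b :: h2' => Z.add a b :: addf h1' h2'
  | [::], _ => h2
  | _, [::] => h1
  end.

Definition oppf (h : form) : form := map Z.opp h.

Definition subf (h1 h2 : form) : form := addf h1 (oppf h2).

Fixpoint dot (h x : seq Z) : Z :=
  match h, x with
  | a :: h', b :: x' => Z.add (Z.mul a b) (dot h' x')
  | _, _ => Z0
  end.

Definition unit_forms : seq form :=
  [seq [seq Z.of_nat (i == j) | j <- iota 0 10] | i <- iota 0 10].

Definition l1norm (h : form) : Z := foldr (fun a => Z.add (Z.abs a)) Z0 h.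

Definition is_zero (h : form) := all (Z.eqb Z0) h.

Section Evaluation.
Variable K : realType.
Implicit Types (h : form) (x : seq K) (p : seq Z) (ys : seq form).
Local Open Scope ring_scope.

Definition ofZ (z : Z) : K := (int_of_Z z)%:~R.

Lemma ofZD a b : ofZ (Z.add a b) = ofZ a + ofZ b.
Proof. by rewrite /ofZ -intrD -raddfD. Qed.

Lemma ofZM a b : ofZ (Z.mul a b) = ofZ a * ofZ b.
Proof. by rewrite /ofZ -intrM -rmorphM. Qed.

Lemma ofZN a : ofZ (Z.opp a) = - ofZ a.
Proof. by rewrite /ofZ -mulrNz -raddfN. Qed.

Lemma ofZ_nat n : ofZ (Z.of_nat n) = n%:R.
Proof. by rewrite /ofZ (_ : int_of_Z _ = n%:Z) //; lia. Qed.

Lemma ofZ_ge0 a : (0 <= ofZ a) = Z.leb Z0 a.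
Proof. by rewrite /ofZ ler0z; lia. Qed.

Lemma ofZ_gt0 a : (0 < ofZ a) = Z.ltb Z0 a.
Proof. by rewrite /ofZ ltr0z; lia. Qed.

Lemma ofZ_eq0 a : (ofZ a == 0) = Z.eqb Z0 a.
Proof. by rewrite /ofZ intr_eq0; lia. Qed.

Lemma ofZ_inj : injective ofZ.
Proof. by move=> a b /intr_inj; lia. Qed.

Fixpoint ev h x : K :=
  match h, x with
  | a :: h', b :: x' => ofZ a * b + ev h' x'
  | _, _ => 0
  end.

Lemma ev_nil h : ev h [::] = 0.
Proof. by case: h. Qed.

Lemma ev_add h1 h2 x : ev (addf h1 h2) x = ev h1 x + ev h2 x.
Proof.
elim: h1 h2 x => [|a h1 IH] [|b h2] [|c x] //=; rewrite ?addr0 ?add0r //.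
by rewrite IH ofZD; ring.
Qed.

Lemma ev_opp h x : ev (oppf h) x = - ev h x.
Proof.
elim: h x => [|a h IH] [|c x] /=; rewrite ?oppr0 // IH ofZN; ring.
Qed.

Lemma ev_sub h1 h2 x : ev (subf h1 h2) x = ev h1 x - ev h2 x.
Proof. by rewrite ev_add ev_opp. Qed.

Lemma ev_ofZ h p : ev h (map ofZ p) = ofZ (dot h p).
Proof. by elim: h p => [|a h IH] [|b p] //=; rewrite IH ofZD ofZM. Qed.

Lemma ev_is_zero h x : is_zero h -> ev h x = 0.
Proof.
elim: h x => [|a h IH] [|b x] //= /andP[a0 h0].
by rewrite IH // (eqP (_ : ofZ a == 0)) ?ofZ_eq0 // mul0r addr0.
Qed.

Lemma ev_linear (T : Type) h (s : seq T) (a : K) (f g : T -> K) :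
  ev h [seq a * f i + g i | i <- s] = a * ev h (map f s) + ev h (map g s).
Proof.
elim: h s => [|c h IH] [|i s] /=; rewrite ?mulr0 ?addr0 //.
by rewrite IH; ring.
Qed.

Definition ev_all (ys : seq form) x : seq K := map (ev^~ x) ys.

Lemma nth_ev_all ys x k : (ev_all ys x)`_k = ev (nth [::] ys k) x.
Proof.
have [lt|ge] := ltnP k (size ys); first by rewrite (nth_map [::]).
by rewrite !nth_default ?size_map // ev_nil.
Qed.

Lemma ev_unit_forms (x : seq K) : size x = 10%N -> ev_all unit_forms x = x.
Proof.
do 10 ![case: x => // ? x] => //; case: x => // _; rewrite /ev_all /=.
have -> : ofZ Z0 = 0 by exact: ofZ_nat 0%N.
have -> : ofZ (Zpos xH) = 1 by exact: ofZ_nat 1%N.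
by rewrite !mul0r !mul1r !add0r !addr0.
Qed.

Definition nonneg x h := 0 <= ev h x.

Definition pos x h := 0 < ev h x.

End Evaluation.

(** * Cells of Lusztig's function *)

(** The words occurring along the sequence of moves matter only through the
kind of each move: the flag says whether it exchanges two commuting letters. *)
Fixpoint steps_of (w ks : seq nat) : seq (nat * bool) :=
  if ks is k :: ks' then
    (k, far (nth 0 w k) (nth 0 w k.+1)) :: steps_of (move_word w k) ks'
  else [::].

Definition steps : seq (nat * bool) :=
  Eval vm_compute in steps_of word_j moves_j_j'.

Definition swap_at (T : Type) (x0 : T) (x : seq T) k :=
  take k x ++ [:: nth x0 x k.+1; nth x0 x k] ++ drop k.+2 x.

Definition comparison (xs : seq form) k : form :=
  subf (nth [::] xs k.+2) (nth [::] xs k).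

(** A long braid relation on a tuple of forms, on the side where the comparison
c - a is nonnegative if [s] holds, nonpositive otherwise. *)
Definition braid_at (xs : seq form) k (s : bool) : seq form :=
  let a := nth [::] xs k in let b := nth [::] xs k.+1 in
  let c := nth [::] xs k.+2 in
  take k xs
  ++ (if s then [:: subf (addf b c) a; a; b] else [:: b; c; subf (addf b a) c])
  ++ drop k.+3 xs.

Definition signed (s : bool) (h : form) := if s then h else oppf h.

(** The signed comparisons met along the moves when the branches follow [sg],
and the forms that give the final coordinates there. *)
Fixpoint cell_from (st : seq (nat * bool)) (xs : seq form) (sg : seq bool) :
    seq form * seq form :=
  match st with
  | [::] => ([::], xs)
  | (k, true) :: st' => cell_from st' (swap_at [::] xs k) sg
  | (k, false) :: st' =>
      let s := head true sg in
      let: (cs, ys) := cell_from st' (braid_at xs k s) (behead sg) in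
      (signed s (comparison xs k) :: cs, ys)
  end.

Fixpoint walk_from (pos : form -> bool) (st : seq (nat * bool))
    (xs : seq form) : seq bool :=
  match st with
  | [::] => [::]
  | (k, true) :: st' => walk_from pos st' (swap_at [::] xs k)
  | (k, false) :: st' =>
      let s := pos (comparison xs k) in
      s :: walk_from pos st' (braid_at xs k s)
  end.

Definition cell := cell_from steps unit_forms.

Definition walk pos := walk_from pos steps unit_forms.

Definition sign_pattern (p : seq Z) : seq bool :=
  walk (fun h => Z.leb Z0 (dot h p)).

Definition values_at (ys : seq form) (p : seq Z) : seq Z :=
  [seq dot (nth [::] ys k) p | k <- iota 0 10].

Definition strictly_in (sg : seq bool) (p : seq Z) : bool :=
  all (fun h => Z.ltb Z0 (dot h p)) (cell sg).1.

Section Cells.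
Variable K : realType.
Implicit Types (h : form) (x : seq K) (p : seq Z).
Local Open Scope ring_scope.

Lemma ev_signed s h x : ev (signed s h) x = if s then ev h x else - ev h x.
Proof. by case: s; rewrite ?ev_opp. Qed.

(** On the cell of a sign pattern, every branch taken by Lusztig's function is
the one prescribed by the pattern; where a comparison vanishes the two branches
agree. *)
Lemma transport_cell ks w xs sg x :
  all (fun h => 0 <= ev h x) (cell_from (steps_of w ks) xs sg).1 ->
  transport w ks (ev_all xs x) = ev_all (cell_from (steps_of w ks) xs sg).2 x.
Proof.
elim: ks w xs sg => //= k ks IH w xs sg.
rewrite {1}/move_coords; case: (far _ _).
  move=> /IH <-; congr transport.
  by rewrite /swap_at /ev_all !map_cat /= map_take map_drop !nth_ev_all.
case E: (cell_from _ _ _) => [cs ys] /= /andP[h0 cs0].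
have := IH (move_word w k) (braid_at xs k (head true sg)) (behead sg).
rewrite E /= => <- //; congr transport.
rewrite /braid_at /ev_all !map_cat map_take map_drop; congr (_ ++ (_ ++ _)).
rewrite !nth_ev_all; move: h0; rewrite ev_signed /comparison ev_sub.
set c := ev _ _; set a := ev _ _; case: (head true sg) => h0 /=.
  by rewrite subr_ge0 in h0; rewrite ev_sub ev_add h0.
rewrite ev_sub ev_add; case: ifP => // ac.
have eq_ac : a = c by apply/le_anti; lra.
rewrite -/a -/c eq_ac; congr [:: _; _; _]; ring.
Qed.

Lemma stepsE : steps = steps_of word_j moves_j_j'.
Proof. by vm_compute. Qed.

Lemma transport_j_cell sg (x : seq K) : size x = 10%N ->
  all (nonneg x) (cell sg).1 ->
  transport word_j moves_j_j' x = ev_all (cell sg).2 x.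
Proof.
move=> sz; rewrite /cell stepsE => cs0.
by rewrite -[in LHS](ev_unit_forms sz) (transport_cell cs0).
Qed.

Lemma nonneg_cell_walk st xs x :
  all (nonneg x) (cell_from st xs (walk_from (nonneg x) st xs)).1.
Proof.
elim: st xs => //= -[k []] st IH xs //=.
case: (boolP (nonneg x _)) => h0 /=; case E: (cell_from _ _ _) => [cs ys] /=;
  have := IH (braid_at xs k (nonneg x (comparison xs k)));
  rewrite ?(negbTE h0) ?h0 E => ->; rewrite andbT ?h0 //.
by rewrite /nonneg ev_opp oppr_ge0 ltW // ltNge.
Qed.

Lemma size_walk ps st xs :
  size (walk_from ps st xs) = count (fun s : nat * bool => ~~ s.2) st.
Proof. by elim: st xs => //= -[k []] st IH xs /=; rewrite IH. Qed.

Lemma eq_walk ps ps' st xs :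
  ps =1 ps' -> walk_from ps st xs = walk_from ps' st xs.
Proof. by move=> e; elim: st xs => //= -[k []] st IH xs //=; rewrite e IH. Qed.

(** An interior point of a cell lies in no other cell: where two patterns first
differ, the same comparison would have to be positive and nonpositive. *)
Lemma cell_pos_inj st xs sg sg' x :
  size sg = count (fun s : nat * bool => ~~ s.2) st -> size sg' = size sg ->
  all (pos x) (cell_from st xs sg).1 ->
  all (nonneg x) (cell_from st xs sg').1 -> sg' = sg.
Proof.
elim: st xs sg sg' => [|[k []] st IH] xs sg sg' /=.
- by move=> /size0nil -> /size0nil ->.
- exact: IH.
case: sg => [|s sg] //= [sz]; case: sg' => [|s' sg'] //= [sz'].
case E: (cell_from _ _ _) => [cs ys].
case E': (cell_from _ _ _) => [cs' ys'] /=.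
move=> /andP[h0 cs0] /andP[h0' cs0']; have es : s' = s.
  move: h0 h0'; rewrite /pos /nonneg !ev_signed.
  by case: (s) (s') => -[] //; lra.
rewrite es in E' *; congr (_ :: _).
by apply: (IH (braid_at xs k s)); rewrite ?E ?E'.
Qed.

End Cells.

(* Simplification must not unfold the moves, which would produce the complete
   tree of branches. *)
Arguments cell : simpl never.
Arguments walk : simpl never.
Arguments values_at : simpl never.
Arguments sign_pattern : simpl never.

(** * Feasible sign patterns *)

(** Boolean connectives evaluate both arguments under call by value; here and
below, [if] avoids exploring alternatives that are not needed. *)
Fixpoint find_some (T : Type) (a : pred T) (s : seq T) : bool :=
  if s is x :: s' then if a x then true else find_some a s' else false.

Lemma find_someE T (a : pred T) s : find_some a s = has a s.
Proof. by elim: s => //= x s ->. Qed.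

(** A sound but incomplete search for [h] as a sum of at most [n] forms of
[ctx]. It stays small because it only subtracts forms that do not increase the
l1 norm; depth 4 suffices to refute every sign pattern whose cell has empty
interior. *)
Fixpoint entails (n : nat) (ctx : seq form) (h : form) : bool :=
  if is_zero h then true else
  if n is n'.+1 then
    find_some (fun u =>
      let d := subf h u in
      if Z.leb (l1norm d) (l1norm h) then entails n' ctx d else false) ctx
  else false.

(** A branch is dropped when [prune] derives the opposite sign of its
comparison from the comparisons [ctx] met before. *)
Fixpoint patterns_from (prune : seq form -> form -> bool)
    (st : seq (nat * bool)) (xs ctx : seq form) : seq (seq bool) :=
  match st with
  | [::] => [:: [::]]
  | (k, true) :: st' => patterns_from prune st' (swap_at [::] xs k) ctx
  | (k, false) :: st' =>
      let h := comparison xs k in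
      let branch s :=
        if prune ctx (signed (~~ s) h) then [::]
        else map (cons s)
               (patterns_from prune st'
                  (braid_at xs k s) (signed s h :: ctx)) in
      branch true ++ branch false
  end.

(** Stored evaluated, since several checks run through it. *)
Definition feasible : seq (seq bool) :=
  Eval vm_compute in patterns_from (entails 4) steps unit_forms [::].

Lemma feasibleE : patterns_from (entails 4) steps unit_forms [::] = feasible.
Proof. by vm_cast_no_check (erefl feasible). Qed.

Definition all_patterns :=
  patterns_from (fun _ _ => false) steps unit_forms [::].

Section Patterns.
Variable K : realType.
Implicit Types (h : form) (x : seq K).
Local Open Scope ring_scope.

Lemma entails_sound n ctx h x :
  entails n ctx h -> all (pos x) ctx -> nonneg x h.
Proof.
rewrite /nonneg; elim: n h => [|n IH] h /=.
  by case: ifP => // /ev_is_zero ->.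
case: ifP => [/ev_is_zero -> //|_].
rewrite find_someE => /hasP[u ctxu]; case: ifP => // _ ent_d /[dup] ctx0.
move=> /allP/(_ u ctxu); have := IH _ ent_d ctx0; rewrite ev_sub /pos; lra.
Qed.

Lemma walk_in_patterns (prune : seq form -> form -> bool) st xs ctx x :
  (forall ctx' h, prune ctx' h -> all (pos x) ctx' -> nonneg x h) ->
  all (pos x) ctx ->
  all (pos x) (cell_from st xs (walk_from (nonneg x) st xs)).1 ->
  walk_from (nonneg x) st xs \in patterns_from prune st xs ctx.
Proof.
move=> sound; elim: st xs ctx => //= -[k []] st IH xs ctx ctx0; first exact: IH.
set h := comparison xs k; set s := nonneg x h.
case E: (cell_from _ _ _) => [cs ys] /= /andP[h0 cs0].
have mem_s : s :: walk_from (nonneg x) st (braid_at xs k s) \in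
   (if prune ctx (signed (~~ s) h) then [::]
    else map (cons s)
           (patterns_from prune st (braid_at xs k s) (signed s h :: ctx))).
  case: ifP => [/sound/(_ ctx0)|_].
    by move: h0; rewrite /nonneg /pos !ev_signed; case: (s) => /=; lra.
  by apply/map_f/IH; rewrite ?E //= h0.
by rewrite mem_cat; case: (s) mem_s => ->; rewrite ?orbT.
Qed.

Lemma walk_in_all_patterns st xs ctx x :
  walk_from (nonneg x) st xs \in patterns_from (fun _ _ => false) st xs ctx.
Proof.
elim: st xs ctx => //= -[k []] st IH xs ctx //=.
set h := comparison xs k; rewrite mem_cat.
by case: (nonneg x h); rewrite map_f ?orbT.
Qed.

End Patterns.

Arguments feasible : simpl never.
Arguments all_patterns : simpl never.
Opaque cell walk all_patterns sign_pattern values_at.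

(** * Regions of linearity *)

(** The test on the square of the form makes the form itself, seen as a vector,
a direction in which it increases. *)
Definition nondegenerate h := (size h == 10%N) && Z.ltb Z0 (dot h h).

Lemma comparisons_nondegenerate :
  all nondegenerate (flatten [seq (cell sg).1 | sg <- all_patterns]).
Proof. by vm_cast_no_check (erefl true). Qed.

Section Regions.
Variable K : realType.
Implicit Types (h : form) (v u : 'rV[K]_10) (p : seq Z) (cs ys : seq form).
Local Open Scope classical_set_scope.
Local Open Scope ring_scope.

Definition coords v : seq K := [seq v 0 i | i <- enum 'I_10].

Lemma size_coords v : size (coords v) = 10%N.
Proof. by rewrite size_map size_enum_ord. Qed.

Definition vecZ p : 'rV[K]_10 := \row_k ofZ K (nth Z0 p k).

Lemma coords_vecZ p : size p = 10%N -> coords (vecZ p) = map (ofZ K) p.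
Proof.
move=> sz; rewrite /coords (eq_map (g := fun k : 'I_10 => ofZ K (nth Z0 p k))).
  rewrite -[in RHS](mkseq_nth Z0 p) sz /mkseq -val_enum_ord -!map_comp.
  exact: eq_map.
by move=> k; rewrite mxE.
Qed.

Lemma ev_vecZ h p : size p = 10%N -> ev h (coords (vecZ p)) = ofZ K (dot h p).
Proof. by move=> sz; rewrite coords_vecZ // ev_ofZ. Qed.

Lemma nth_addf p q k : nth Z0 (addf p q) k = Z.add (nth Z0 p k) (nth Z0 q k).
Proof.
by elim: p q k => [|a p IH] [|b q] [|k] //=; rewrite ?nth_nil ?Z.add_0_r //.
Qed.

Lemma size_addf p q : size (addf p q) = maxn (size p) (size q).
Proof. by elim: p q => [|a p IH] [|b q] //=; rewrite IH maxnSS. Qed.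

Lemma vecZD p q : vecZ (addf p q) = vecZ p + vecZ q.
Proof. by apply/rowP=> k; rewrite !mxE nth_addf ofZD. Qed.

Lemma ev_coords_linear h a u v :
  ev h (coords (a *: u + v)) = a * ev h (coords u) + ev h (coords v).
Proof.
rewrite /coords -ev_linear; congr ev; apply: eq_map => i; by rewrite !mxE.
Qed.

Lemma ev_coordsZ h a u : ev h (coords (a *: u)) = a * ev h (coords u).
Proof.
have := ev_coords_linear h a u 0; rewrite addr0 => ->.
have := ev_coords_linear h (-1) 0 0; rewrite scaler0 addr0; lra.
Qed.

Lemma ev_coordsD h u v :
  ev h (coords (u + v)) = ev h (coords u) + ev h (coords v).
Proof. by have := ev_coords_linear h 1 u v; rewrite scale1r mul1r. Qed.

Lemma ev_coords0 h : ev h (coords (0 : 'rV[K]_10)) = 0.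
Proof. by have := ev_coordsZ h 0 (0 : 'rV[K]_10); rewrite scale0r mul0r. Qed.

Lemma ev_coords_sum h (I : finType) (c : I -> K) (g : I -> 'rV[K]_10) :
  ev h (coords (\sum_i c i *: g i)) = \sum_i c i * ev h (coords (g i)).
Proof.
rewrite (big_morph (fun v => ev h (coords v)) (ev_coordsD h) (ev_coords0 h)).
by apply: eq_bigr => i _; exact: ev_coordsZ.
Qed.

Lemma nonneg_orthantE v :
  nonneg_orthant K v <-> all (nonneg (coords v)) unit_forms.
Proof.
have -> : all (nonneg (coords v)) unit_forms =
          all (>= 0) (ev_all unit_forms (coords v)).
  by rewrite all_map.
rewrite (ev_unit_forms (size_coords v)) /coords all_map.
split=> [v0|/allP v0 k]; first by apply/allP => k _; exact: v0.
by apply: v0; rewrite mem_enum.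
Qed.

Definition values n (ys : seq form) v : 'rV[K]_n :=
  \row_k ev (nth [::] ys k) (coords v).

Fact values_is_linear n ys : linear (values n ys).
Proof. by move=> a u v; apply/rowP=> k; rewrite !mxE ev_coords_linear. Qed.

HB.instance Definition _ n ys :=
  GRing.isLinear.Build K 'rV[K]_10 'rV[K]_n *:%R (values n ys)
    (@values_is_linear n ys).

Definition forms_mx n (hs : 'I_n -> form) : 'M[K]_(10, n) :=
  lin1_mx (values n [seq hs k | k <- enum 'I_n]).

Lemma forms_mxE n (hs : 'I_n -> form) v k :
  (v *m forms_mx hs) 0 k = ev (hs k) (coords v).
Proof.
rewrite mul_rV_lin1 mxE (nth_map k) ?size_enum_ord //.
by rewrite nth_ord_enum.
Qed.

Lemma values_at_inj ys ys' p : size p = 10%N ->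
  values 10 ys (vecZ p) = values 10 ys' (vecZ p) ->
  values_at ys p = values_at ys' p.
Proof.
move=> sz /rowP e; apply/eq_in_map => k; rewrite mem_iota => k10.
have := e (Ordinal (k10 : (k < 10)%N)); rewrite !mxE /= !ev_vecZ //.
exact: ofZ_inj.
Qed.

Definition cell_set (sg : seq bool) : set 'rV[K]_10 :=
  [set v | all (nonneg (coords v)) (cell sg).1].

Definition open_cell (sg : seq bool) : set 'rV[K]_10 :=
  [set v | all (pos (coords v)) (cell sg).1].

Lemma open_cell_sub sg v : open_cell sg v -> cell_set sg v.
Proof. by apply: sub_all => h; exact: ltW. Qed.

Definition pattern_at v := walk (nonneg (coords v)).

Lemma pattern_at_cell v : cell_set (pattern_at v) v.
Proof. exact: nonneg_cell_walk. Qed.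

Lemma sign_patternE p : size p = 10%N -> sign_pattern p = pattern_at (vecZ p).
Proof.
by move=> sz; apply: eq_walk => h; rewrite /nonneg ev_vecZ // ofZ_ge0.
Qed.

Lemma strictly_inE sg p : size p = 10%N ->
  strictly_in sg p -> open_cell sg (vecZ p).
Proof. by move=> sz; apply: sub_all => h; rewrite /pos ev_vecZ // ofZ_gt0. Qed.

Lemma lusztig_R_cell sg v :
  cell_set sg v -> lusztig_R v = values 10 (cell sg).2 v.
Proof.
move=> cs0; apply/rowP=> k; rewrite !mxE -nth_ev_all; congr nth.
by apply: transport_j_cell cs0; rewrite size_map size_enum_ord.
Qed.

Lemma continuous_addM_coord (a : K) (i : 'I_10) f :
  continuous f -> continuous (fun v : 'rV[K]_10 => a * v 0 i + f v).
Proof.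
move=> cf; have cont_coord : continuous (fun v : 'rV[K]_10 => a * v 0 i).
  move=> v.
  apply: (@continuous_comp _ _ _ (fun u : 'rV[K]_10 => u 0 i) ( *%R a)).
    exact: coord_continuous.
  exact: mulrl_continuous.
by move=> v; exact: (cvgD (cont_coord v) (cf v)).
Qed.

Lemma continuous_ev h : continuous (fun v => ev h (coords v)).
Proof.
rewrite /coords; elim: h (enum 'I_10) => [|a h IH] [|i s] /=;
  try exact: cst_continuous.
by apply: continuous_addM_coord; exact: IH.
Qed.

Lemma open_pos cs : open [set v | all (pos (coords v)) cs].
Proof.
elim: cs => [|h cs IH] /=.
  by rewrite (_ : [set _ | _] = setT); [exact: openT | apply/seteqP; split].
rewrite (_ : [set _ | _] =
  [set v | pos (coords v) h] `&` [set v | all (pos (coords v)) cs]); last first.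
  by apply/seteqP; split => v /= => [/andP[]|[-> ->]].
apply: openI IH.
have := @open_comp _ _ (fun v => ev h (coords v)) [set x | 0 < x].
apply; last exact: open_gt.
by move=> v _; exact: continuous_ev.
Qed.

Lemma closed_nonneg cs : closed [set v | all (nonneg (coords v)) cs].
Proof.
elim: cs => [|h cs IH] /=.
  by rewrite (_ : [set _ | _] = setT); [exact: closedT | apply/seteqP; split].
rewrite (_ : [set _ | _] =
  [set v | nonneg (coords v) h] `&` [set v | all (nonneg (coords v)) cs]);
  last first.
  by apply/seteqP; split => v /= => [/andP[]|[-> ->]].
apply: closedI IH.
have := @closed_comp _ _ (fun v => ev h (coords v)) [set x | 0 <= x].
apply; last exact: closed_ge.
by move=> v _; exact: continuous_ev.
Qed.

Lemma open_segment (O : set 'rV[K]_10) v u : open O -> O v ->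
  exists2 e : K, 0 < e & O (v + e *: u).
Proof.
move=> oO Ov; have /nbhs_normP[e /= e0 sub] : nbhs v O by exact: open_nbhs_nbhs.
pose t := e / 2 / (1 + `|u|).
have u1 : 0 < 1 + `|u| by rewrite ltr_pwDl.
have t0 : 0 < t by rewrite !divr_gt0.
exists t => //; apply: sub => /=.
rewrite opprD addNKr normrN normrZ gtr0_norm //.
have : t * (1 + `|u|) = e / 2 by rewrite /t divfK // gt_eqF.
by have := normr_ge0 u; nra.
Qed.

(** Finitely many hyperplanes do not cover a nonempty open set: a point on one
of them is moved off it while staying in the open set and off the others. *)
Lemma generic_point (O : set 'rV[K]_10) (hs : seq form) :
  open O -> O !=set0 -> all nondegenerate hs ->
  exists2 v, O v & all (fun h => ev h (coords v) != 0) hs.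
Proof.
move=> + + hs0; elim: hs hs0 O => [_ O _ [v Ov]|h hs IH]; first by exists v.
move=> /= /andP[/andP[/eqP sz h0] hs0] O oO O0.
pose H := [set v | ev h (coords v) != 0].
have oH : open H.
  have := @open_comp _ _ (fun v => ev h (coords v)) [set x | x != 0].
  apply; last exact: open_neq.
  by move=> v _; exact: continuous_ev.
have [||v [Ov Hv] hsv] := IH hs0 (O `&` H); first exact: openI; last first.
  by exists v => //; rewrite hsv andbT.
case: O0 => v Ov; have [v0|v0] := eqVneq (ev h (coords v)) 0; last by exists v.
have [e e0 Oe] := open_segment (vecZ h) oO Ov.
exists (v + e *: vecZ h); split => //.
rewrite /H /= ev_coordsD ev_coordsZ v0 add0r.
by rewrite ev_vecZ // gt_eqF // mulr_gt0 // ofZ_gt0.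
Qed.

Lemma linear_eq_open (f g : {linear 'rV[K]_10 -> 'rV[K]_10})
    (O : set 'rV[K]_10) :
  open O -> O !=set0 -> (forall v, O v -> f v = g v) -> f =1 g.
Proof.
move=> oO [v Ov] eq_fg u; have [e e0 Oe] := open_segment u oO Ov.
have := eq_fg _ Oe; rewrite !linearD !linearZ /= eq_fg // => /addrI.
by move/(scalerI (lt0r_neq0 e0)).
Qed.

(** A generic point of the open set has nonzero comparisons, so it is interior
to the cell of its own sign pattern, and the pruned search cannot have dropped
this pattern. *)
Lemma open_cell_feasible (O : set 'rV[K]_10) : open O -> O !=set0 ->
  exists v sg, [/\ O v, sg \in feasible & open_cell sg v].
Proof.
move=> oO O0; have [v Ov ne0] := generic_point oO O0 comparisons_nondegenerate.
have strict : open_cell (pattern_at v) v.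
  apply/allP => h mem_h; have /allP/(_ h mem_h) := pattern_at_cell v.
  rewrite /pos /nonneg lt_def => ->; rewrite andbT; apply: (allP ne0).
  apply/flattenP; exists (cell (pattern_at v)).1 => //.
  by apply: (map_f (fun sg => (cell sg).1)); exact: walk_in_all_patterns.
exists v, (pattern_at v); split=> //.
rewrite -feasibleE; apply: walk_in_patterns => // ctx h.
exact: entails_sound.
Qed.

Definition chart_set ys : set 'rV[K]_10 :=
  [set v | lusztig_R v = values 10 ys v].

(** The linear map of a region agrees with the linear map of a cell on a
nonempty open set, hence everywhere. *)
Lemma region_feasible X : region_of_linearity X ->
  exists2 sg, sg \in feasible & X = closure (chart_set (cell sg).2)°.
Proof.
move=> [f /= []]; set E := [set _ | _] => E0 ->.
have [v [sg [Ev fsg sgv]]] := open_cell_feasible (open_interior E) E0.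
exists sg => //; congr (closure (interior _)).
suff eq_f : f =1 values 10 (cell sg).2.
  by apply/seteqP; split => u /=; rewrite /chart_set /E /= eq_f.
apply: (@linear_eq_open _ _ (E° `&` open_cell sg)).
- by apply: openI; [exact: open_interior | exact: open_pos].
- by exists v.
- move=> u [/interior_subset Eu sgu]; rewrite -Eu.
  exact/lusztig_R_cell/open_cell_sub.
Qed.

Lemma open_cell_chart sg : open_cell sg `<=` (chart_set (cell sg).2)°.
Proof.
rewrite -open_subsetE; last exact: open_pos.
by move=> v /open_cell_sub; exact: lusztig_R_cell.
Qed.

Lemma open_cell_segment sg u v (e : K) : cell_set sg v -> open_cell sg u ->
  0 < e -> open_cell sg (v + e *: u).
Proof.
move=> /allP sgv /allP sgu e0; apply/allP=> h mem_h.
have := sgv h mem_h; have := sgu h mem_h.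
rewrite /pos /nonneg ev_coordsD ev_coordsZ => u0 v0.
by rewrite ltr_wpDl // mulr_gt0.
Qed.

(** If the set where R agrees with the linear map of the cell [sg] had an
interior point outside this cell, then it would contain an interior point of
another feasible cell with the same linear map. Conversely, the cell is the
closure of its interior, because the segment from any of its points to the
interior point [u] runs inside its interior. *)
Lemma closure_chart_cell sg u :
  open_cell sg u ->
  (forall sg', sg' \in feasible ->
     (forall v, values 10 (cell sg').2 v = values 10 (cell sg).2 v) ->
     sg' = sg) ->
  closure (chart_set (cell sg).2)° = cell_set sg.
Proof.
move=> sgu uniq_sg; apply/seteqP; split=> v; last first.
  move=> sgv B /nbhs_interior B0.
  have [e e0 Be] := open_segment u (open_interior B) (nbhs_singleton B0).
  exists (v + e *: u); split; last exact: interior_subset.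
  exact/open_cell_chart/open_cell_segment.
have cell_closed : closed (@cell_set sg) by exact: closed_nonneg.
suff sub : (chart_set (cell sg).2)° `<=` cell_set sg.
  by move/(closure_subset sub); rewrite -(closure_id _).1.
move=> {}v Ev; apply: contrapT => nsgv.
have [||w [sg' [[Ew nsgw] fsg' sgw]]] :=
    @open_cell_feasible ((chart_set (cell sg).2)° `&` ~` cell_set sg).
- by apply: openI; [exact: open_interior | exact: closed_openC].
- by exists v.
suff e : sg' = sg by apply: nsgw; rewrite -e; exact: open_cell_sub.
apply: uniq_sg => // x.
apply: (@linear_eq_open (values 10 (cell sg').2) (values 10 (cell sg).2)
          ((chart_set (cell sg).2)° `&` open_cell sg')).
- by apply: openI; [exact: open_interior | exact: open_pos].
- by exists w.
- move=> y [/interior_subset Ey sgy]; rewrite -[RHS]Ey.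
  by rewrite (lusztig_R_cell (open_cell_sub sgy)).
Qed.

Lemma closed_exists_in (T : eqType) (s : seq T) (A : T -> set 'rV[K]_10) :
  (forall i, closed (A i)) -> closed [set v | exists2 i, i \in s & A i v].
Proof.
move=> cA; elim: s => [|i s IH].
  rewrite (_ : [set _ | _] = set0); first exact: closed0.
  by apply/seteqP; split => v // [].
rewrite (_ : [set _ | _] = A i `|` [set v | exists2 i, i \in s & A i v]).
  exact: closedU.
apply/seteqP; split=> v /=.
  by move=> [j /predU1P[-> | sj] Aj]; [left | right; exists j].
move=> [Ai|[j sj Aj]]; first by exists i; rewrite ?mem_head.
by exists j; rewrite ?inE ?sj ?orbT.
Qed.

Lemma closed_values_eq ys ys' :
  closed [set v | values 10 ys v = values 10 ys' v :> 'rV[K]_10].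
Proof.
have -> : [set v | values 10 ys v = values 10 ys' v :> 'rV[K]_10] =
   [set v | all (nonneg (coords v))
     ([seq subf (nth [::] ys k) (nth [::] ys' k) | k <- iota 0 10] ++
      [seq subf (nth [::] ys' k) (nth [::] ys k) | k <- iota 0 10])].
  apply/seteqP; split => v; rewrite /mkset all_cat !all_map.
    move/rowP=> e; apply/andP; split; apply/allP=> k; rewrite mem_iota;
      move=> k10; have := e (Ordinal (k10 : (k < 10)%N)); rewrite !mxE /= => ek;
      by rewrite /nonneg !ev_sub ek subrr lexx.
  move=> /andP[/allP e1 /allP e2]; apply/rowP => k; rewrite !mxE.
  have kin : val k \in iota 0 10 by rewrite mem_iota /=.
  have := e1 _ kin; have := e2 _ kin; rewrite /= /nonneg !ev_sub !subr_ge0.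
  by move=> le1 le2; apply/le_anti; rewrite le1.
exact: closed_nonneg.
Qed.

(** This is how continuity of R enters: the set is a finite union over the
cells. *)
Lemma closed_chart_set ys : closed (chart_set ys).
Proof.
rewrite (_ : chart_set ys = [set v | exists2 sg, sg \in all_patterns &
  (cell_set sg `&` [set v | values 10 (cell sg).2 v = values 10 ys v]) v]).
  apply: closed_exists_in => sg.
  by apply: closedI; [exact: closed_nonneg | exact: closed_values_eq].
apply/seteqP; split => v /=.
  move=> Ev; exists (pattern_at v); first exact: walk_in_all_patterns.
  split; first exact: pattern_at_cell.
  by rewrite /= -Ev (lusztig_R_cell (pattern_at_cell v)).
move=> [sg _ [sgv eq_v]]; rewrite /chart_set /= -[RHS]eq_v.
exact: lusztig_R_cell.
Qed.

End Regions.

(** * Regions that need more than six inequalities *)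

(** Seven points for a region of linearity with at least seven facets, each
point beyond one facet only. All comparisons vanish on v_1, ..., v_4, so the
first four coordinates can be normalized to 0. One region is chosen in each
orbit of the symmetries [flip] and [dual] below. *)
Section Heptads.
Local Open Scope Z_scope.
Definition heptads : seq (seq (seq Z)) :=
  map (map (cat [:: 0; 0; 0; 0])) [::
    [:: [:: -1; 0; 3; -3; 1; 2]; [:: 2; -2; -1; 0; 7; 0]; [:: 0; 3; -3; -1;
      2; 8]; [:: -4; -1; 4; -1; -5; 2]; [:: -3; 1; 0; 2; 0; 3]; [:: 2; 0; 2;
      4; 4; -1]; [:: -1; -3; 0; 2; 1; 0]];
    [:: [:: -2; -3; 1; -4; 2; -1]; [:: -4; -2; 3; -2; -1; -3]; [:: 1; -2;
      -2; -2; 7; -3]; [:: -4; -2; -1; -2; 1; 1]; [:: -2; -2; -1; -3; 0; -1];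
      [:: -4; -2; 0; 1; 0; -5]; [:: -4; 1; -3; -2; 0; 0]];
    [:: [:: -4; -3; 2; -7; -2; 1]; [:: -2; -4; 3; -5; -3; -1]; [:: -2; 1;
      -2; -7; -3; 7]; [:: -2; -4; -2; -2; 1; 2]; [:: -2; -3; -1; -2; 0; -1];
      [:: -2; -3; 0; 0; -6; 1]; [:: 1; -4; -4; -1; 0; 2]];
    [:: [:: -2; -5; 3; -6; 2; -1]; [:: -5; -2; 3; -6; -1; 2]; [:: 1; -2; -3;
      -6; 8; 2]; [:: -2; -3; 0; -6; 0; 1]; [:: -2; -2; 0; -3; 2; 2]; [:: -3;
      -2; 0; -4; 1; 0]; [:: -2; 1; -3; -9; 2; 8]];
    [:: [:: 2; -3; -4; 5; 8; -1]; [:: 2; -3; -4; 2; 11; -1]; [:: 2; 3; -4;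
      2; 5; 5]; [:: 2; 0; -1; 2; 5; -1]; [:: 2; 0; -1; 2; 5; 2]; [:: -1; 0;
      -4; 2; 5; 2]; [:: 2; 3; -4; -1; 8; 5]];
    [:: [:: -5; -3; -4; 5; 1; -1]; [:: -5; -3; -4; 2; 4; -1]; [:: -3; 3; -4;
      2; 0; 5]; [:: -3; 0; -1; 2; 0; -1]; [:: -3; 0; -1; 2; 0; 2]; [:: 1; 0;
      -4; 2; 7; 2]; [:: -5; 3; -4; -1; 1; 5]];
    [:: [:: -2; -5; 4; 2; 1; -7]; [:: 1; 0; 2; -1; 3; -2]; [:: 1; -5; 2; 4;
      3; -7]; [:: -3; 0; 2; 4; -1; -2]; [:: 0; 0; 2; 2; 2; 1]; [:: 4; 2; -1;
      2; 6; 0]; [:: 1; 2; 2; 2; 0; 0]];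
    [:: [:: -4; -5; 2; 7; -2; -7]; [:: -4; -3; 2; 2; 0; -5]; [:: -4; 1; 2;
      2; -5; -1]; [:: -2; 1; -1; 2; 0; -1]; [:: -4; 0; 2; 2; 0; 1]; [:: -1; 0;
      2; 2; 1; -2]; [:: -4; 3; 2; -1; 0; 0]];
    [:: [:: -3; -6; 2; 9; -1; -8]; [:: 4; -7; 3; 3; 6; -9]; [:: -3; -10; 6;
      6; -1; -12]; [:: 0; -3; 2; 3; -1; -5]; [:: 1; -6; 2; 7; 3; -5]; [:: 1;
      -3; 2; 4; 3; -5]; [:: 4; -3; -1; 6; 6; -5]];
    [:: [:: 2; -3; -2; 5; 6; -5]; [:: 2; -3; -2; 2; 9; -5]; [:: 2; 3; -2; 2;
      3; 0]; [:: 2; 0; -2; 2; 6; 1]; [:: 2; 0; 1; 2; 3; -2]; [:: -1; 0; -2; 2;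
      3; -2]; [:: 2; 3; -2; -1; 6; 0]];
    [:: [:: -4; -3; -2; 5; 0; -5]; [:: -5; -3; -2; 2; 2; -5]; [:: -2; 3; -3;
      2; 0; 0]; [:: -4; 0; -2; 2; 0; 1]; [:: -2; 0; 1; 2; 0; -2]; [:: 1; 0;
      -2; 2; 5; -2]; [:: -4; 3; -2; -1; 0; 0]];
    [:: [:: -3; 2; -4; 3; -1; 8]; [:: 4; 2; -4; -4; 6; 9]; [:: -3; 2; -4;
      -4; -1; 12]; [:: 0; 2; -1; 0; -1; 5]; [:: -1; 2; -1; 1; 1; 6]; [:: -1;
      -1; -4; 1; 1; 6]; [:: 4; 2; -4; 3; 6; 5]];
    [:: [:: -3; 2; -2; 3; -5; 6]; [:: 4; 2; -2; -4; 0; 7]; [:: -3; 2; -2;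
      -4; -5; 10]; [:: 0; 2; -2; 0; 1; 6]; [:: 1; 2; 1; 1; -2; 3]; [:: 1; -1;
      -2; 1; -2; 3]; [:: 4; 2; -2; 3; 1; 3]];
    [:: [:: -4; -6; 0; 0; -1; 2]; [:: -4; 1; -6; -5; -2; 13]; [:: -7; -2; 0;
      -5; -4; 7]; [:: -4; -3; 0; -1; -5; 3]; [:: -3; -5; 0; -1; -1; 0]; [::
      -4; -3; -2; 2; -2; 2]; [:: -1; -3; -6; 2; 1; 6]];
    [:: [:: -3; 2; -5; 2; 0; 5]; [:: -2; 2; 1; 2; -6; -2]; [:: -2; 2; -2; 2;
      -6; 5]; [:: -2; 2; -4; -1; 0; 0]; [:: -2; -1; -5; 2; 0; 0]; [:: 1; 2;
      -2; 2; 0; 0]; [:: -3; 2; -2; 2; 0; -2]];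
    [:: [:: 2; -2; -5; 4; 5; 1]; [:: 2; -2; 1; 4; -2; -6]; [:: 2; -2; -2; 4;
      -2; 1]; [:: 2; -2; -4; 1; 0; 0]; [:: 2; 1; -2; 1; 1; 0]; [:: -1; -2; -4;
      4; -2; 0]; [:: 2; -2; -2; 4; 5; -6]];
    [:: [:: -3; -2; -5; 4; 0; 1]; [:: -2; -2; 1; 4; -6; -6]; [:: -2; -2; -2;
      4; -6; 1]; [:: -2; -2; -6; 1; 0; 0]; [:: -2; 1; -4; 1; 0; 0]; [:: 1; -2;
      -4; 4; 0; 0]; [:: -3; -2; -2; 4; 0; -6]];
    [:: [:: 3; -5; 2; 0; 0; -3]; [:: 1; -1; -1; 1; -1; 2]; [:: 1; -4; 2; 6;
      -1; -5]; [:: -4; -4; 2; 1; -6; 0]; [:: 1; -4; 2; 1; 2; 0]; [:: 1; -2; 3;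
      1; -1; 0]; [:: -8; -4; 2; 8; -10; 1]];
    [:: [:: -4; -4; -1; 0; -2; 3]; [:: -4; -6; 5; -3; -5; 0]; [:: -1; -6; 1;
      -1; 2; -1]; [:: -6; -7; -1; 6; 0; -1]; [:: -4; -3; 0; -1; 0; 3]; [:: -2;
      -5; 0; 2; 0; 1]; [:: -4; -12; 7; 8; -1; -13]];
    [:: [:: 2; 2; -2; -5; 6; 5]; [:: 2; 2; -5; -2; 9; 5]; [:: 2; 2; 1; -2;
      3; -1]; [:: 2; -1; -2; -2; 6; -1]; [:: 2; 2; -2; -2; 3; 0]; [:: -1; 2;
      -2; -2; 3; 0]; [:: 2; 2; -2; 1; 6; -1]];
    [:: [:: 2; -5; -1; -1; 6; 0]; [:: 2; 1; -9; -6; 7; 12]; [:: 2; -2; -5;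
      -6; 10; 5]; [:: 2; -3; -1; -1; 3; 0]; [:: -1; -4; -4; -1; 4; 2]; [:: 2;
      -4; -4; 2; 7; -1]; [:: 2; -2; -5; 0; 3; 6]];
    [:: [:: -3; -2; -2; 5; -5; 2]; [:: 4; -4; -2; 0; 0; 1]; [:: -3; -5; -2;
      1; -5; 3]; [:: 0; -2; -2; 1; 1; 3]; [:: 1; -2; 1; 1; -2; 0]; [:: 1; 1;
      -2; 1; -2; 5]; [:: 4; -2; -3; 5; 1; 0]];
    [:: [:: -2; 2; -6; -5; 2; 11]; [:: -5; 2; -3; -2; -4; 8]; [:: 1; 2; -9;
      -2; 8; 8]; [:: -4; -1; -6; -2; 0; 5]; [:: -4; 2; -3; -2; 0; 5]; [:: -2;
      2; -4; -2; 0; 5]; [:: -4; 2; -6; 1; 0; 5]];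
    [:: [:: -2; 2; -4; -5; 4; 9]; [:: -5; 2; -1; -2; 0; 6]; [:: 1; 2; -7;
      -2; 10; 6]; [:: -5; -1; -4; -2; 1; 3]; [:: -3; 2; -4; -2; 0; 6]; [:: -3;
      2; -1; -2; 0; 3]; [:: -5; 2; -4; 1; 1; 3]]].
End Heptads.

Definition R_at (p : seq Z) : seq Z := values_at (cell (sign_pattern p)).2 p.

Definition permute (s : seq nat) (p : seq Z) : seq Z :=
  [seq nth Z0 p i | i <- s].

(** Reading a word backwards preserves both words between which R is defined,
up to exchanging commuting neighbours, and the long braid relation is symmetric
under it. So this permutation of the coordinates commutes with R. *)
Definition flip := permute [:: 8; 9; 6; 7; 4; 5; 2; 3; 0; 1].

(** The linear map of the region surrounded by the seven points of [c], read
off at the sum of the first two. *)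
Definition middle_image (c : seq (seq Z)) : seq form :=
  (cell (sign_pattern (addf (nth [::] c 0) (nth [::] c 1)))).2.

(** R followed by the diagram automorphism is an involution, up to exchanging
commuting neighbours; hence it permutes the regions of linearity, and its
linear extension carries points around a region to points around the image
region. *)
Definition dual (c : seq (seq Z)) : seq (seq Z) :=
  let ys := middle_image c in
  [seq permute [:: 1; 0; 3; 2; 5; 4; 7; 6; 9; 8] (values_at ys p) | p <- c].

Definition all_heptads : seq (seq (seq Z)) :=
  let hs := heptads ++ map dual heptads in hs ++ map (map flip) hs.

Definition heptad_ok (c : seq (seq Z)) : bool :=
  let ys := middle_image c in
  [&& size c == 7, all (fun p => size p == 10) c,
      all (fun p => R_at p != values_at ys p) c &
      pairwise (fun p q => let sg := sign_pattern (addf p q) in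
                  strictly_in sg (addf p q) && ((cell sg).2 == ys)) c].

Lemma heptads_ok : all heptad_ok all_heptads.
Proof. by vm_cast_no_check (erefl true). Qed.

Section SevenPoints.
Variable K : realType.
Local Open Scope classical_set_scope.
Local Open Scope ring_scope.

(** Seven points outside a region violate some of its inequalities; with six
inequalities, two points violate the same one, and so does their sum. The sums,
however, lie in open cells with the linear map of the region. *)
Lemma heptad_not6 c (X : set 'rV[K]_10) (A : 'M[K]_(10, 6)) :
  heptad_ok c -> X = closure (chart_set (middle_image c))° ->
  defined_by X A -> False.
Proof.
set ys := middle_image c.
move=> /and4P[/eqP sz /allP sz10 /allP outside inside] Xdef XA.
have memc k : (k < 7)%N -> nth [::] c k \in c.
  by move=> k7; rewrite mem_nth // sz.
pose q (k : 'I_7) := vecZ K (nth [::] c k).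
have q_out k : ~ X (q k).
  rewrite Xdef => /(closure_subset (@interior_subset _ _)).
  rewrite -(closure_id _).1; last exact: closed_chart_set.
  rewrite /chart_set /= (lusztig_R_cell (pattern_at_cell _)).
  have s10 := eqP (sz10 _ (memc k (ltn_ord k))).
  rewrite -sign_patternE // => /(values_at_inj s10) e.
  by have /eqP := outside _ (memc k (ltn_ord k)); apply.
have q_in (k l : 'I_7) : (k < l)%N -> X (q k + q l).
  move=> kl; rewrite Xdef -vecZD; apply: subset_closure.
  have /(pairwiseP [::])/(_ k l) := inside.
  rewrite !inE sz => /(_ (ltn_ord k) (ltn_ord l) kl) /andP[st /eqP eq_ys].
  rewrite /ys -eq_ys.
  apply: open_cell_chart; apply: strictly_inE => //.
  by rewrite size_addf !(eqP (sz10 _ (memc _ (ltn_ord _)))).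
have [j j_neg] : exists j : 'I_7 -> 'I_6, forall k, (q k *m A) 0 (j k) < 0.
  apply: (@fin_all_exists _ (fun _ => 'I_6)
            (fun k j => (q k *m A) 0 j < 0)) => k.
  apply: contrapT => no_neg; apply: (q_out k); rewrite XA /= => j.
  by rewrite leNgt; apply/negP => neg; apply: no_neg; exists j.
have /injectivePn[k [l ne_kl eq_j]] : ~~ injectiveb j.
  by apply/negP => /injectiveP/leq_card; rewrite !card_ord.
wlog kl : k l ne_kl eq_j / (k < l)%N.
  move=> W; have := ne_kl; rewrite -val_eqE neq_ltn => /orP[|lk].
    exact: W.
  by apply: (W l k) => //; rewrite eq_sym.
have := q_in k l kl; rewrite XA /= => /(_ (j k)); rewrite mulmxDl mxE.
by have := j_neg k; have := j_neg l; rewrite -eq_j; lra.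
Qed.

End SevenPoints.

(** * Walls of a simplicial cone *)

Section SimplicialCone.
Variables (K : realType) (G : 'M[K]_10).
Hypothesis unitG : G \in unitmx.
Implicit Types (k l : 'I_10) (u v : 'rV[K]_10) (H : {vspace 'rV[K]_10}).
Local Open Scope classical_set_scope.
Local Open Scope ring_scope.

Definition coordinate k v : K := (v *m invmx G) 0 k.

Lemma coordinate_row k l : coordinate k (row l G) = (l == k)%:R.
Proof. by rewrite /coordinate -row_mul mulmxV // !mxE. Qed.

Lemma sum_coordinates v : v = \sum_k coordinate k v *: row k G.
Proof. by rewrite -[LHS](mulmxKV unitG) mulmx_sum_row. Qed.

Lemma coordinateE k v : coordinate k v = (v *m col k (invmx G)) 0 0.
Proof. by rewrite /coordinate !mxE; apply: eq_bigr => i _; rewrite !mxE. Qed.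

Definition cone : set 'rV[K]_10 := [set v | forall k, 0 <= coordinate k v].

Lemma row_cone k : cone (row k G).
Proof. by move=> l; rewrite coordinate_row ler0n. Qed.

(** The hyperplane through all rows of [G] but the [k]-th, as the kernel of the
[k]-th coordinate. *)
Definition opposite k : {vspace 'rV[K]_10} :=
  lker (linfun (mulmxr (col k (invmx G)) : 'rV[K]_10 -> 'rV[K]_1)).

Lemma opposite_coordinate k v : (v \in opposite k) = (coordinate k v == 0).
Proof.
rewrite memv_ker lfunE /= coordinateE; apply/eqP/eqP => [->|v0].
  by rewrite mxE.
by apply/matrixP => i j; rewrite !ord1 v0 mxE.
Qed.

Lemma row_opposite k l : (row l G \in opposite k) = (l != k).
Proof. by rewrite opposite_coordinate coordinate_row pnatr_eq0 eqb0. Qed.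

Lemma opposite_inj : injective opposite.
Proof.
move=> k l e; apply/eqP/contraT => ne.
by have := row_opposite k l; rewrite e row_opposite eqxx eq_sym ne.
Qed.

Lemma dim_space : \dim {: 'rV[K]_10} = 10%N.
Proof. by rewrite dimvf /dim /= mul1n. Qed.

Lemma dim_opposite k : \dim (opposite k) = 9%N.
Proof.
rewrite /opposite; set f := linfun _.
have := limg_ker_dim f fullv; rewrite capfv dim_space.
have : (\dim (limg f) <= 1)%N.
  by rewrite (leq_trans (dimvS (subvf _))) // dimvf /dim /= mul1n.
have : (0 < \dim (limg f))%N.
  rewrite lt0n dimv_eq0; apply/eqP => f0.
  have := memv_img f (memvf (row k G)); rewrite f0 memv0 -memv_ker.
  by rewrite -/(opposite k) row_opposite eqxx.
move=> lim_gt0 lim_le1; have -> : \dim (limg f) = 1%N.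
  by apply/eqP; rewrite eqn_leq lim_le1.
by rewrite addn1 => -[].
Qed.

Lemma opposite_sub k H :
  (forall l, l != k -> row l G \in H) -> (opposite k <= H)%VS.
Proof.
move=> GH; apply/subvP => v; rewrite opposite_coordinate => /eqP v0.
rewrite [v]sum_coordinates (bigD1 k) //= v0 scale0r add0r.
by apply: memv_suml => l lk; apply/memvZ/GH.
Qed.

Lemma opposite_unique k H : hyperplane H ->
  (forall l, l != k -> row l G \in H) -> opposite k = H.
Proof.
by move=> dimH GH; apply/eqP; rewrite eqEdim opposite_sub // dimH dim_opposite.
Qed.

Lemma is_span_cone : is_span cone fullv.
Proof.
split=> [v _|H coneH]; first exact: memvf.
apply/subvP => v _; rewrite [v]sum_coordinates.
by apply: memv_suml => k _; apply/memvZ/coneH/row_cone.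
Qed.

Lemma is_span_opposite k :
  is_span (cone `&` [set v | coordinate k v = 0]) (opposite k).
Proof.
split=> [v [_ /= v0]|H FH]; first by rewrite opposite_coordinate v0.
apply: opposite_sub => l lk; apply: FH; split; first exact: row_cone.
by rewrite /= coordinate_row (negbTE lk).
Qed.

(** A wall misses some generator [row k G], so the form that exposes its facet
is positive there; points of the facet then have [k]-th coordinate zero, and
the wall is contained in, hence equal to, the [k]-th opposite hyperplane. *)
Lemma walls_cone : walls cone = range opposite.
Proof.
apply/seteqP; split=> [H [dimH [F [[a a_ge0 FE] _] [FH Hmin]]] | _ [k _ <-]].
  have [k nGk] : exists k, row k G \notin H.
    apply: contrapT => allG; have : (fullv <= H)%VS.
      apply/subvP => v _; rewrite [v]sum_coordinates; apply: memv_suml => k _.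
      apply: memvZ; apply: contraT => nGk; case: allG; by exists k.
    by move/dimvS; rewrite dimH dim_space.
  exists k => //; apply/eqP.
  rewrite eq_sym eqEdim dim_opposite dimH leqnn andbT.
  apply: Hmin => v; rewrite FE => -[v_cone /= va0].
  have value u : (u *m a) 0 0 = \sum_l coordinate l u * (row l G *m a) 0 0.
    rewrite {1}[u]sum_coordinates mulmx_suml summxE.
    by apply: eq_bigr => l _; rewrite -scalemxAl mxE.
  have ak : (row k G *m a) 0 0 != 0.
    apply: contra nGk => /eqP ak0; apply: FH; rewrite FE; split => //.
    exact: row_cone.
  have /eqP := va0; rewrite value psumr_eq0 => [/allP/(_ k)|l _]; last first.
    by rewrite mulr_ge0 ?a_ge0 //; exact: row_cone.
  rewrite mem_index_enum mulf_eq0 (negbTE ak) orbF opposite_coordinate.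
  exact.
split; first exact: dim_opposite.
exists (cone `&` [set v | coordinate k v = 0]); last exact: is_span_opposite.
split.
  exists (col k (invmx G)) => [v|]; first by rewrite -coordinateE; apply.
  by congr (_ `&` _); apply/seteqP; split=> v /=; rewrite -coordinateE.
exists fullv, (opposite k).
split; [exact: is_span_cone | exact: is_span_opposite |].
by rewrite dim_opposite dim_space.
Qed.

End SimplicialCone.

Lemma card_range_ord n (T : Type) (f : 'I_n -> T) :
  injective f -> (range f #= `I_n)%card.
Proof.
move=> f_inj; rewrite (card_eqr card_II); apply: inj_card_eq.
by move=> x y _ _; exact: f_inj.
Qed.

(** * Commutation classes *)

(** Inserting the letters of a word one by one, from the right, gives the
lexicographically least word of its commutation class. *)
Fixpoint insert (p : nat) (w : seq nat) : seq nat :=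
  if w is q :: w' then
    if far p q && (q < p) then q :: insert p w' else p :: w
  else [:: p].

Definition nf (w : seq nat) : seq nat := foldr insert [::] w.

Lemma far_sym p q : far p q = far q p.
Proof. by rewrite /far orbC. Qed.

(** This is what makes [nf] invariant under commutations. *)
Lemma insertC p q w : far p q -> insert p (insert q w) = insert q (insert p w).
Proof.
wlog lt_qp : p q / q < p.
  move=> W pq; have := pq; rewrite /far => pq'; case: (ltngtP q p) => [||e].
  - by move=> ?; exact: W.
  - by move=> ?; rewrite -W // far_sym.
  - by move: pq'; rewrite e; lia.
move=> pq; elim: w => [|r w IH] /=.
  by rewrite pq lt_qp far_sym pq /= ltnNge ltnW.
have qp : far q p && (p < q) = false by lia.
case: (boolP (far q r && (r < q))) => [qr|nqr] /=.
  have pr : far p r && (r < p) by move: pq qr; rewrite /far; lia.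
  by rewrite pr /= qr IH.
rewrite pq lt_qp /=; case: (boolP (far p r && (r < p))) => [pr|npr] /=.
  by rewrite (negbTE nqr).
by rewrite qp.
Qed.

Lemma nf_step w w' : commutation_step w w' -> nf w = nf w'.
Proof.
move=> [u [v [p [q [pq -> ->]]]]]; rewrite /nf !foldr_cat /=.
by congr foldr; exact: insertC.
Qed.

Lemma same_class_cons r w w' :
  same_commutation_class w w' -> same_commutation_class (r :: w) (r :: w').
Proof.
elim=> [x y [u [v [p [q [pq -> ->]]]]]|x|x y z _ IHx _ IHy].
- by apply: rt_step; exists (r :: u), v, p, q.
- exact: rt_refl.
- exact: rt_trans IHx IHy.
Qed.

Lemma same_class_sym w w' :
  same_commutation_class w w' -> same_commutation_class w' w.
Proof.
elim=> [x y [u [v [p [q [pq -> ->]]]]]|x|x y z _ IHx _ IHy].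
- by apply: rt_step; exists u, v, q, p; rewrite far_sym.
- exact: rt_refl.
- exact: rt_trans IHy IHx.
Qed.

Lemma same_class_insert p w : same_commutation_class (p :: w) (insert p w).
Proof.
elim: w => [|q w IH] /=; first exact: rt_refl.
case: ifP => [/andP[pq _]|_]; last exact: rt_refl.
apply: rt_trans (same_class_cons q IH).
by apply: rt_step; exists [::], w, p, q.
Qed.

Lemma same_class_nf w : same_commutation_class w (nf w).
Proof.
elim: w => [|p w IH]; first exact: rt_refl.
exact: rt_trans (same_class_cons p IH) (same_class_insert p (nf w)).
Qed.

Lemma same_classP w w' : same_commutation_class w w' <-> nf w = nf w'.
Proof.
split=> [|e].
  by elim=> [x y /nf_step|//|x y z _ -> _ ->].
apply: rt_trans (same_class_nf w) _; rewrite e.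
exact/same_class_sym/same_class_nf.
Qed.

(** * Reduced expressions of the longest element *)

Definition letters := iota 1 4.

Definition labels := iota 1 5.

Definition swap_letter (p : nat) (x : seq nat) := swap_at 0 x p.-1.

Definition predecessors (xs : seq (seq nat)) : seq (seq nat) :=
  undup [seq swap_letter p x | p <- letters, x <- xs].

(** The first entry holds the arrangements from which the reversed one is
reached in exactly [n] steps. Membership in the successive levels prunes the
enumeration of words: a prefix that wastes a step leaves its level. *)
Fixpoint levels (n : nat) : seq (seq (seq nat)) :=
  if n is n'.+1 then
    let lv := levels n' in predecessors (head [::] lv) :: lv
  else [:: [:: rev labels]].

Fixpoint words_from (lv : seq (seq (seq nat))) (x : seq nat) : seq (seq nat) :=
  if lv is xs :: lv' then
    if x \in xs then
      if lv' is [::] then [:: [::]] else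
      flatten [seq [seq p :: w | w <- words_from lv' (swap_letter p x)]
              | p <- letters]
    else [::]
  else [::].

Definition letter p := 0 < p < 5.

Definition arrangement (w : seq nat) : seq nat :=
  mkseq (fun n => label (word_perm w (inord n))) 5.

Lemma letter_cases p : letter p -> [\/ p = 1, p = 2, p = 3 | p = 4].
Proof. by case: p => [|[|[|[|[|p]]]]] //; constructor. Qed.

Lemma sgen_inord p n : letter p -> n < 5 ->
  sgen p (inord n) =
  inord (if n == p.-1 then p else if n == p then p.-1 else n).
Proof.
rewrite /letter /sgen => p5 n5; case: eqP => [->|ne1]; first by rewrite tpermL.
case: eqP => [->|ne2]; first by rewrite tpermR.
by rewrite tpermD //; apply/eqP => /(congr1 val); rewrite /= !inordK; lia.
Qed.

Lemma arrangement_rcons w p : letter p ->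
  arrangement (rcons w p) = swap_letter p (arrangement w).
Proof.
move=> p5; have word_rcons m : word_perm (rcons w p) m = word_perm w (sgen p m).
  by rewrite /word_perm rev_rcons big_cons permM.
rewrite /arrangement /mkseq /= !word_rcons !sgen_inord //.
by case: (letter_cases p5) => ->.
Qed.

Lemma arrangement_foldl w : all letter w ->
  arrangement w = foldl (fun x p => swap_letter p x) labels w.
Proof.
elim/last_ind: w => [_|w p IH].
  by rewrite /arrangement /mkseq /word_perm big_nil /= !perm1 /label !inordK.
by rewrite all_rcons foldl_rcons => /andP[p5 /IH <-]; exact: arrangement_rcons.
Qed.

Lemma arrangement_w0 w : word_perm w = w0 -> arrangement w = rev labels.
Proof.
move=> e; rewrite /arrangement /mkseq e /= /w0 !permE /label /= !inordK //.
Qed.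

Lemma size_swap_letter p x :
  letter p -> size x = 5 -> size (swap_letter p x) = 5.
Proof.
move=> /letter_cases p5; do 5 ![case: x => // ? x]; case: x => // _.
by case: p5 => ->.
Qed.

Lemma swap_letterK p x :
  letter p -> size x = 5 -> swap_letter p (swap_letter p x) = x.
Proof.
move=> /letter_cases p5; do 5 ![case: x => // ? x]; case: x => // _.
by case: p5 => ->.
Qed.

Lemma mem_letters p : letter p -> p \in letters.
Proof. by move=> /letter_cases []->. Qed.

Lemma words_from_cons xs lv x : 0 < size lv -> x \in xs ->
  words_from (xs :: lv) x =
  flatten [seq [seq p :: w | w <- words_from lv (swap_letter p x)]
          | p <- letters].
Proof. by case: lv => // ys lv _ xs_x; rewrite [LHS]/= xs_x. Qed.

Lemma words_from_complete w x : all letter w -> size x = 5 ->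
  foldl (fun x p => swap_letter p x) x w = rev labels ->
  x \in head [::] (levels (size w)) /\ w \in words_from (levels (size w)) x.
Proof.
elim: w x => [|p w IH] x; first by move=> _ _ /= ->; rewrite mem_head.
move=> /andP[p5 w5] sx e.
have [mem_x mem_w] := IH _ w5 (size_swap_letter p5 sx) e.
have mem_x' : x \in predecessors (head [::] (levels (size w))).
  rewrite mem_undup -[x in x \in _](swap_letterK p5 sx).
  by apply: allpairs_f => //; exact: mem_letters.
split=> //; rewrite [levels _]/= words_from_cons //; last by case: (size w).
apply/flattenP; eexists; first exact/map_f/(mem_letters p5).
exact: map_f.
Qed.

Lemma reduced_in_words w : reduced_w0 w -> w \in words_from (levels 10) labels.
Proof.
case/and3P=> /eqP sz w5 /eqP ww.
have e := arrangement_w0 ww; rewrite arrangement_foldl in e; last exact: w5.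
by have [_] := words_from_complete w5 (erefl _ : size labels = 5) e; rewrite sz.
Qed.

(** * Chamber sets and partial quivers *)

Definition symbol_code (e : symbol) : option bool :=
  match e with L => Some true | R => Some false | U => None end.

Definition symbol_decode (o : option bool) : symbol :=
  match o with Some true => L | Some false => R | None => U end.

Lemma symbol_codeK : cancel symbol_code symbol_decode.
Proof. by case. Qed.

HB.instance Definition _ := Equality.copy symbol (can_type symbol_codeK).

Definition quivers : seq word3 :=
  let es := [:: L; R; U] in
  [seq P <- [seq (ab, c) | ab <- [seq (a, b) | a <- es, b <- es], c <- es]
     | partial_quiver P].

Definition in_l (P : word3) (n : nat) : bool :=
  [|| has (fun e => (e.1 == n) && is_L e.2) (edges P),
      let: (i, e) := last (0, U) (directed_edges P) in is_R e && (n <= i.-1)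
    | let: (j, e) := head (0, U) (directed_edges P) in is_R e && (j.+1 <= n)].

Definition label_mask (A : pred nat) : seq bool := map A labels.

(** Along the word, [x] is the arrangement reached so far; the strings below
the chamber that opens with the letter [p] are those at the places after the
[p]-th one. *)
Fixpoint chambers (x w : seq nat) : seq (seq bool) :=
  if w is p :: w' then
    let x' := swap_letter p x in
    let cs := chambers x' w' in
    if p \in w' then label_mask (mem (drop p x')) :: cs else cs
  else [::].

Definition quiver_masks : seq (word3 * seq bool) :=
  [seq (P, label_mask (in_l P)) | P <- quivers].

Definition quivers_in (w : seq nat) : seq word3 :=
  let cs := chambers labels w in
  [seq Pm.1 | Pm <- quiver_masks & Pm.2 \in cs].

Lemma mem_chambers m x w : reflect
  (exists s, [/\ s < size w, nth 0 w s \in drop s.+1 w & m =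
     label_mask (mem (drop (nth 0 w s)
       (foldl (fun x p => swap_letter p x) x (take s.+1 w))))])
  (m \in chambers x w).
Proof.
elim: w x => [|p w IH] x /=; first by constructor=> -[s []].
set x' := swap_letter p x; have IHx' := IH x'.
apply: (iffP idP) => [mem_m|[[|s] [/= sw rep e]]].
- have [m0|/IHx'[s [sw rep ->]]] : m = label_mask (mem (drop p x')) /\ p \in w
      \/ m \in chambers x' w.
  + by move: mem_m; case: ifP => pw; [move=> /predU1P[]; [left|right] | right].
  + by exists 0; rewrite drop0 take0 /=; case: m0.
  + by exists s.+1.
- by rewrite drop0 take0 /= in rep e; rewrite rep e mem_head.
- have : m \in chambers x' w by apply/IHx'; exists s.
  by case: ifP => // _ mem_s; rewrite inE mem_s orbT.
Qed.

Definition set_mask (A : {set 'I_5}) : seq bool :=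
  label_mask (fun n => inord n.-1 \in A).

Lemma set_mask_inj : injective set_mask.
Proof.
move=> A B /eq_in_map e; apply/setP => m.
have /e : label m \in labels.
  by rewrite mem_iota; have := ltn_ord m; rewrite /label; lia.
by rewrite /= inord_val.
Qed.

Lemma has_consecutive w (s : 'I_10) : size w = 10 ->
  [exists s', consecutive w s s'] = (nth 0 w s \in drop s.+1 w).
Proof.
move=> sz; apply/existsP/idP => [[s' /and3P[lt_s /eqP e _]]|rep].
  rewrite e -(subnKC lt_s) -nth_drop mem_nth // size_drop sz.
  by have := ltn_ord s'; lia.
(* the next occurrence of the letter *)
set d := index (nth 0 w s) (drop s.+1 w).
have d_lt : d < 10 - s.+1.
  by have := index_mem (nth 0 w s) (drop s.+1 w); rewrite rep size_drop sz.
have s'10 : s.+1 + d < 10 by lia.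
exists (Ordinal s'10); apply/and3P; split=> /=; first by lia.
  by rewrite -nth_drop nth_index.
apply/forallP => r; apply/implyP => /andP[sr rs'].
have := @before_find _ 0 (pred1 (nth 0 w s)) (drop s.+1 w) (r - s.+1).
rewrite nth_drop subnKC // -/(index _ _) -/d /= => H.
by apply/negbT/H; lia.
Qed.

Lemma set_mask_chamber w (s : 'I_10) : reduced_w0 w ->
  set_mask (chamber_set w s) =
  label_mask (mem (drop (nth 0 w s)
     (foldl (fun x p => swap_letter p x) labels (take s.+1 w)))).
Proof.
case/and3P=> /eqP sz w5 _; have w5' : all letter (take s.+1 w).
  by apply/allP => p /mem_take; apply: (allP w5).
rewrite -arrangement_foldl //; apply/eq_in_map => n; rewrite mem_iota => n5.
pose F := word_perm (take s.+1 w).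
have p5 : 0 < nth 0 w s < 5 by apply: (allP w5); rewrite mem_nth // sz.
rewrite /chamber_set /= /arrangement /mkseq -map_drop drop_iota add0n -/F.
apply/imsetP/mapP => [[m]|[k]].
  rewrite inE => lt_m e; exists (val m); last first.
    by rewrite inord_val -/F -e /label inordK //; lia.
  rewrite mem_iota subnKC; first by rewrite -ltnS lt_m /=; exact: ltn_ord.
  by case/andP: p5 => _ /ltnW.
rewrite mem_iota => k5 e; exists (inord k).
  by rewrite inE /label inordK; lia.
rewrite -/F; apply/val_inj; rewrite /= inordK; last lia.
by move: e; rewrite /label => ->.
Qed.

Lemma set_mask_l P : set_mask (l P) = label_mask (in_l P).
Proof.
apply/eq_in_map => n; rewrite mem_iota => n5.
have label_n : label (inord n.-1) = n by rewrite /label inordK; lia.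
rewrite /l /in_l /l1 /l2 /l3 !finset.in_setU finset.in_set label_n -orbA.
congr [|| _, _ | _].
  by case: (last _ _) => i e; case: (is_R e);
    rewrite ?finset.in_set ?finset.in_set0 ?label_n.
by case: (head _ _) => i e; case: (is_R e);
  rewrite ?finset.in_set ?finset.in_set0 ?label_n.
Qed.

Lemma mem_quivers P : (P \in quivers) = partial_quiver P.
Proof. by case: P => -[[] []] []. Qed.

Lemma mem_quivers_in w P : reduced_w0 w ->
  P \in quivers_in w <-> quivers_of w P.
Proof.
move=> red_w; have /and3P[/eqP sz _ _] := red_w.
have -> : P \in quivers_in w =
    partial_quiver P && (label_mask (in_l P) \in chambers labels w).
  apply/mapP/andP => [[[Q m]]|[qP lP]].
    rewrite mem_filter /= => /andP[cm /mapP[Q' qQ' [-> em]]] ->.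
    by rewrite -em -mem_quivers.
  exists (P, label_mask (in_l P)) => //; rewrite mem_filter /= lP.
  by apply/mapP; exists P; rewrite ?mem_quivers.
rewrite /quivers_of -set_mask_l.
split=> [/andP[-> /mem_chambers[s [sw rep e]]]|[-> lP]].
  split=> //; rewrite sz in sw; apply/imsetP; exists (Ordinal sw).
    by rewrite inE has_consecutive.
  by apply: set_mask_inj; rewrite set_mask_chamber.
apply/mem_chambers; move/imsetP: lP => [s].
rewrite inE has_consecutive // => rep ->.
by exists s; rewrite sz set_mask_chamber.
Qed.

(** * The simplicial region of a commutation class *)

(** The entries of the vectors v_P, kept apart from the field so that dot
products can be evaluated. *)
Definition quiver_coords (P : word3) : seq nat :=
  match P with
  | (L, L, L) => [:: 1; 0; 0; 0; 0; 0; 0; 0; 0; 0]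
  | (L, L, R) => [:: 0; 0; 1; 0; 0; 0; 0; 0; 1; 0]
  | (L, R, L) => [:: 1; 1; 0; 0; 0; 0; 1; 1; 0; 0]
  | (R, L, L) => [:: 1; 0; 0; 1; 0; 0; 0; 0; 0; 1]
  | (L, R, R) => [:: 0; 1; 0; 0; 0; 0; 0; 1; 1; 0]
  | (R, L, R) => [:: 0; 0; 1; 1; 0; 0; 0; 0; 1; 1]
  | (R, R, L) => [:: 1; 0; 0; 0; 0; 0; 1; 0; 0; 0]
  | (R, R, R) => [:: 0; 0; 0; 0; 0; 0; 0; 0; 1; 0]
  | (L, L, U) => [:: 0; 0; 0; 0; 0; 0; 0; 1; 0; 0]
  | (L, R, U) => [:: 0; 1; 0; 0; 0; 1; 0; 0; 0; 0]
  | (R, L, U) => [:: 0; 0; 0; 0; 0; 1; 0; 0; 0; 1]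
  | (R, R, U) => [:: 0; 0; 0; 1; 0; 0; 0; 0; 0; 0]
  | (U, L, L) => [:: 1; 0; 0; 0; 0; 0; 0; 0; 0; 1]
  | (U, L, R) => [:: 0; 0; 1; 0; 0; 0; 0; 0; 1; 1]
  | (U, R, L) => [:: 1; 1; 0; 0; 0; 0; 1; 0; 0; 0]
  | (U, R, R) => [:: 0; 1; 0; 0; 0; 0; 0; 0; 1; 0]
  | (L, U, U) => [:: 0; 1; 0; 0; 0; 0; 0; 1; 0; 0]
  | (R, U, U) => [:: 0; 0; 0; 1; 0; 0; 0; 0; 0; 1]
  | (U, L, U) => [:: 0; 0; 1; 0; 0; 0; 0; 0; 0; 1]
  | (U, R, U) => [:: 0; 1; 0; 0; 0; 0; 1; 0; 0; 0]
  | (U, U, L) => [:: 1; 0; 0; 0; 1; 0; 0; 0; 0; 0]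
  | (U, U, R) => [:: 0; 0; 0; 0; 1; 0; 0; 0; 1; 0]
  | _ => [::]
  end.

Definition common_coords : seq (seq nat) :=
  [:: [:: 1; 0; 0; 0; 1; 0; 0; 0; 1; 0];
      [:: 0; 0; 1; 0; 0; 0; 1; 0; 0; 0];
      [:: 0; 1; 0; 0; 0; 1; 0; 0; 0; 1];
      [:: 0; 0; 0; 1; 0; 0; 0; 1; 0; 0]].

Definition quiver_points (w : seq nat) : seq (seq Z) :=
  [seq map Z.of_nat (quiver_coords P) | P <- quivers_in w].

Definition common_points : seq (seq Z) := map (map Z.of_nat) common_coords.

Definition points (w : seq nat) := quiver_points w ++ common_points.

Definition center (w : seq nat) : seq Z := foldr addf [::] (points w).

Definition pattern_of (w : seq nat) : seq bool := sign_pattern (center w).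

Definition nonneg_on (gs : seq (seq Z)) (h : form) : bool :=
  all (fun g => Z.leb Z0 (dot h g)) gs.

Definition zero_on (gs : seq (seq Z)) (h : form) : bool :=
  all (fun g => Z.eqb Z0 (dot h g)) gs.

Definition dual_forms (hs : seq form) (gs all_gs : seq (seq Z)) : bool :=
  all (fun g => has (fun h =>
    all (fun g' => if g' == g then Z.ltb Z0 (dot h g')
                   else Z.eqb Z0 (dot h g')) all_gs) hs) gs.

(** A vector at which the linear maps of distinct regions take distinct values.
*)
Definition probe : seq Z := map Z.of_nat [:: 2; 2; 2; 2; 1; 1; 1; 0; 0; 0].

Definition charts := [seq (sg, values_at (cell sg).2 probe) | sg <- feasible].

(** The signs from which everything about the region of a class follows. The
last condition says that no other feasible pattern has the same linear map. *)
Definition class_ok (w : seq nat) : bool :=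
  let gs := points w in
  let sg := pattern_of w in
  let c := cell sg in
  [&& [&& size gs == 10, uniq gs, all (fun g => size g == 10) gs,
          size (center w) == 10 & strictly_in sg (center w)],
      [&& all (nonneg_on gs) c.1, all (nonneg_on gs) unit_forms
        & all (zero_on common_points) c.1],
      dual_forms c.1 (quiver_points w) gs,
      dual_forms unit_forms common_points gs
    & all (fun sx => (sx.2 == values_at c.2 probe) ==> (sx.1 == sg)) charts].

Section Class.
Variables (K : realType) (w : seq nat).
Hypothesis okw : class_ok w.
Let gs := points w.
Let sg := pattern_of w.
Local Open Scope classical_set_scope.
Local Open Scope ring_scope.

Lemma points_shape : [/\ size gs = 10%N, uniq gs,
  {in gs, forall g, size g = 10%N}, size (center w) = 10%N
  & strictly_in sg (center w)].
Proof.
move: okw; rewrite /class_ok.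
move=> /and5P[/and5P[/eqP ? ? /allP s /eqP ? ?] _ _ _ _].
by split=> // g /s /eqP.
Qed.

Lemma mem_points (k : 'I_10) : nth [::] gs k \in gs.
Proof. by have [s _ _ _ _] := points_shape; rewrite mem_nth // s. Qed.

Definition generator (k : 'I_10) : 'rV[K]_10 := vecZ K (nth [::] gs k).

Lemma ev_generator h k :
  ev h (coords (generator k)) = ofZ K (dot h (nth [::] gs k)).
Proof.
by have [_ _ s _ _] := points_shape; rewrite ev_vecZ // s // mem_points.
Qed.

Lemma comparison_generator_ge0 h k :
  h \in (cell sg).1 -> 0 <= ev h (coords (generator k)).
Proof.
move: okw => /and5P[_ /and3P[/allP c _ _] _ _ _] /c /allP/(_ _ (mem_points k)).
by rewrite ev_generator ofZ_ge0.
Qed.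

Lemma unit_form_generator_ge0 h k :
  h \in unit_forms -> 0 <= ev h (coords (generator k)).
Proof.
move: okw => /and5P[_ /and3P[_ /allP c _] _ _ _] /c /allP/(_ _ (mem_points k)).
by rewrite ev_generator ofZ_ge0.
Qed.

Lemma size_quiver_points : size (quiver_points w) = 6%N.
Proof.
by have [+ _ _ _ _] := points_shape; rewrite size_cat => /(@addIn 4 _ 6).
Qed.

Lemma comparison_common_eq0 h (k : 'I_10) :
  h \in (cell sg).1 -> (6 <= k)%N -> ev h (coords (generator k)) = 0.
Proof.
move: okw => /and5P[_ /and3P[_ _ /allP c] _ _ _] /c /allP z k6.
have /z : nth [::] gs k \in common_points.
  rewrite /gs /points nth_cat size_quiver_points ltnNge k6 /= mem_nth //=.
  by have := ltn_ord k; lia.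
by rewrite ev_generator -(ofZ_eq0 K) => /eqP.
Qed.

Lemma dual_form_exists (k : 'I_10) : exists h,
  [/\ h \in (if (k < 6)%N then (cell sg).1 else unit_forms),
      0 < ev h (coords (generator k)) &
      forall l, l != k -> ev h (coords (generator l)) = 0].
Proof.
have [s u _ _ _] := points_shape.
have [h hs /allP dual_h] : exists2 h,
     h \in (if (k < 6)%N then (cell sg).1 else unit_forms)
   & all (fun g' => if g' == nth [::] gs k then Z.ltb Z0 (dot h g')
                    else Z.eqb Z0 (dot h g')) gs.
  move: okw => /and5P[_ _ /allP dq /allP dc _].
  case: ltnP => k6; apply/hasP; [apply: dq|apply: dc].
    rewrite /gs /points nth_cat size_quiver_points k6 mem_nth //.
    by rewrite size_quiver_points.
  rewrite /gs /points nth_cat size_quiver_points ltnNge k6 /= mem_nth //=.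
  by have := ltn_ord k; lia.
exists h; split => // [|l lk].
  by have := dual_h _ (mem_points k); rewrite eqxx ev_generator ofZ_gt0.
have := dual_h _ (mem_points l).
rewrite nth_uniq ?s // (inj_eq val_inj) (negbTE lk).
by rewrite ev_generator -(ofZ_eq0 K) => /eqP.
Qed.

Lemma chart_class_inj sg' : sg' \in feasible ->
  (forall v, values 10 (cell sg').2 v = values 10 (cell sg).2 v :> 'rV[K]_10) ->
  sg' = sg.
Proof.
move=> fsg' eq_v; have e := values_at_inj (erefl : size probe = 10%N) (eq_v _).
move: okw => /and5P[_ _ _ _ /allP].
move/(_ _ (map_f (fun sg => (sg, values_at (cell sg).2 probe)) fsg')).
by move/implyP => eq_sg; apply/eqP/eq_sg/eqP.
Qed.

Lemma center_open_cell : open_cell sg (vecZ K (center w)).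
Proof. by have [_ _ _ s i] := points_shape; exact: strictly_inE. Qed.

Lemma closure_chart_class :
  closure (chart_set (cell sg).2)° = cell_set sg :> set 'rV[K]_10.
Proof. exact: closure_chart_cell center_open_cell chart_class_inj. Qed.

Lemma region_cell : region_of_linearity (@cell_set K sg).
Proof.
exists (values 10 (cell sg).2); split; last by rewrite -closure_chart_class.
by exists (vecZ K (center w)); apply: open_cell_chart; exact: center_open_cell.
Qed.

Definition generator_mx : 'M[K]_10 := \matrix_k generator k.

(** The dual forms, scaled, are the columns of the inverse of the matrix of
generators; so the generators form a basis and the dual forms read off
coordinates. *)
Lemma dual_system : exists hs : 'I_10 -> form,
  [/\ generator_mx \in unitmx,
      forall k, hs k \in (if (k < 6)%N then (cell sg).1 else unit_forms),
      forall k, 0 < ev (hs k) (coords (generator k)),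
      forall k l, l != k -> ev (hs k) (coords (generator l)) = 0 &
      forall k v, coordinate generator_mx k v =
                  ev (hs k) (coords v) / ev (hs k) (coords (generator k))].
Proof.
have [hs hsP] := fin_all_exists dual_form_exists.
pose d k := ev (hs k) (coords (generator k)).
have d_gt0 k : 0 < d k by case: (hsP k).
have off k l : l != k -> ev (hs k) (coords (generator l)) = 0.
  by case: (hsP k) => _ _; apply.
pose D := \matrix_(i, k) (forms_mx K hs i k / d k).
have D_E v k : (v *m D) 0 k = ev (hs k) (coords v) / d k.
  rewrite -forms_mxE !mxE mulr_suml; apply: eq_bigr => i _.
  by rewrite !mxE mulrA.
have GD : generator_mx *m D = 1%:M.
  apply/row_matrixP => l; rewrite row_mul rowK; apply/rowP => k.
  rewrite D_E [RHS]mxE [RHS]mxE; case: (eqVneq l k) => [->|lk]; last first.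
    by rewrite off ?mul0r.
  by rewrite -/(d k) divff // gt_eqF.
have [unitG _] := mulmx1_unit GD.
exists hs; split=> // [k|k v]; first by case: (hsP k).
have -> : coordinate generator_mx k v = (v *m D) 0 k.
  by rewrite /coordinate -[D]mul1mx -(mulVmx unitG) -mulmxA GD mulmx1.
by rewrite D_E.
Qed.

Lemma unit_generator_mx : generator_mx \in unitmx.
Proof. by have [hs []] := dual_system. Qed.

Lemma ev_coordinates h v :
  ev h (coords v) =
  \sum_k coordinate generator_mx k v * ev h (coords (generator k)).
Proof.
rewrite {1}[v](sum_coordinates unit_generator_mx) ev_coords_sum.
by apply: eq_bigr => k _; rewrite rowK.
Qed.

Lemma cell_orthant_cone : cell_set sg `&` nonneg_orthant K = cone generator_mx.
Proof.
have [hs [_ mem_hs hs_gt0 _ coordE]] := dual_system.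
apply/seteqP; split=> v.
  move=> [/allP sgv /nonneg_orthantE/allP v0] k.
  rewrite coordE divr_ge0 //; last exact: ltW.
  by have := mem_hs k; case: ifP => _; [exact: sgv | exact: v0].
move=> v_cone; split; last apply/nonneg_orthantE; apply/allP => h mem_h;
  rewrite /nonneg ev_coordinates; apply: sumr_ge0 => k _;
  apply: mulr_ge0; do ?[exact: v_cone].
- exact: comparison_generator_ge0.
- exact: unit_form_generator_ge0.
Qed.

(** The comparisons vanish on the last four generators, so that they are
nonnegative combinations of the dual forms of the first six; and the opposite
of one of these six generators violates its own dual form only. *)
Lemma six_inequalities : exists2 A : 'M[K]_(10, 6),
  defined_by (cell_set sg) A & irredundant A.
Proof.
have [hs [_ mem_hs hs_gt0 hs0 coordE]] := dual_system.
have le610 : (6 <= 10)%N by [].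
pose hs6 (k : 'I_6) := hs (widen_ord le610 k).
exists (forms_mx K hs6).
  apply/seteqP; split=> v.
    move=> /allP sgv k; rewrite forms_mxE; apply: sgv.
    by have := mem_hs (widen_ord le610 k); rewrite /= ltn_ord.
  move=> v0; apply/allP => h mem_h; rewrite /nonneg ev_coordinates.
  apply: sumr_ge0 => k _; have [k6|k6] := ltnP k 6; last first.
    by rewrite comparison_common_eq0 ?mulr0.
  rewrite mulr_ge0 ?comparison_generator_ge0 // coordE.
  rewrite divr_ge0 ?(ltW (hs_gt0 k)) //.
  have := v0 (Ordinal k6); rewrite forms_mxE /hs6.
  by rewrite (_ : widen_ord _ _ = k) //; exact: val_inj.
move=> k eq_sets; pose k' := widen_ord le610 k.
have ev_opp_gen l : ev (hs6 l) (coords (- generator k')) =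
    - ev (hs6 l) (coords (generator k')) by rewrite -scaleN1r ev_coordsZ mulN1r.
have : [set v : 'rV[K]_10 | forall l, l != k -> 0 <= (v *m forms_mx K hs6) 0 l]
         (- generator k').
  move=> l lk; rewrite forms_mxE ev_opp_gen hs0 ?oppr0 //.
  by rewrite eq_sym -(inj_eq val_inj) /= (inj_eq val_inj).
rewrite eq_sets => /(_ k); rewrite forms_mxE ev_opp_gen oppr_ge0.
by rewrite leNgt hs_gt0.
Qed.

Lemma simplicial_class : simplicial_region (cell_set sg `&` nonneg_orthant K).
Proof.
exists (cell_set sg); split=> //; first exact: region_cell.
exact: six_inequalities.
Qed.

End Class.

(** * All classes and all regions *)

Definition classes : seq (seq nat) :=
  Eval vm_compute in undup (map nf (words_from (levels 10) labels)).

Lemma classesE : undup (map nf (words_from (levels 10) labels)) = classes.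
Proof. by vm_cast_no_check (erefl classes). Qed.

Lemma classes_ok : all class_ok classes.
Proof. by vm_cast_no_check (erefl true). Qed.

Lemma pattern_of_inj_classes : uniq (map pattern_of classes).
Proof. by vm_cast_no_check (erefl true). Qed.

Definition expresses_w0 (w : seq nat) : bool :=
  [&& size w == 10, all letter w
    & foldl (fun x p => swap_letter p x) labels w == rev labels].

Lemma classes_express_w0 : all expresses_w0 classes.
Proof. by vm_cast_no_check (erefl true). Qed.

Lemma quivers_in_nf_words :
  all (fun w => quivers_in (nf w) == quivers_in w)
    (words_from (levels 10) labels).
Proof. by vm_cast_no_check (erefl true). Qed.

Definition feasible_are_covered : bool :=
  let simplicial := map pattern_of classes in
  let others := map middle_image all_heptads in
  all (fun sg => if sg \in simplicial then true else (cell sg).2 \in others)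
    feasible.

Lemma feasible_covered : feasible_are_covered.
Proof. by vm_cast_no_check (erefl true). Qed.

Lemma uniq_map_inj (T T' : eqType) (f : T -> T') (s : seq T) :
  uniq (map f s) -> {in s &, injective f}.
Proof.
elim: s => //= a s IH /andP[nfa us] x y; rewrite !inE.
move=> /predU1P[->|xs] /predU1P[->|ys] // e; last exact: IH.
  by move: nfa; rewrite e map_f.
by move: nfa; rewrite -e map_f.
Qed.

Lemma nf_class i : reduced_w0 i -> nf i \in classes.
Proof. by move=> /reduced_in_words i_in; rewrite -classesE mem_undup map_f. Qed.

Lemma quivers_in_nf i : reduced_w0 i -> quivers_in (nf i) = quivers_in i.
Proof. by move=> /reduced_in_words/(allP quivers_in_nf_words)/eqP. Qed.

Lemma class_reduced w : w \in classes -> reduced_w0 w.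
Proof.
move=> /(allP classes_express_w0)/and3P[sz w5 /eqP e].
apply/and3P; split=> //; apply/eqP/permP => m.
rewrite -arrangement_foldl // in e.
have : nth 0%N (arrangement w) m = nth 0%N (rev labels) m by rewrite e.
rewrite nth_mkseq ?ltn_ord // inord_val /w0 permE => em.
apply/val_inj/succn_inj; rewrite -[LHS]/(label _) em.
by case: m {em} => [[|[|[|[|[|]]]]]].
Qed.

Lemma nf_fixed w : w \in classes -> nf w = w.
Proof.
rewrite -classesE mem_undup => /mapP[i _ ->].
by apply/esym/same_classP/same_class_nf.
Qed.

Section Main.
Variable K : realType.
Local Open Scope classical_set_scope.
Local Open Scope ring_scope.

Lemma nth_of_nat s k : nth Z0 (map Z.of_nat s) k = Z.of_nat (nth 0%N s k).
Proof. by elim: s k => [|a s IH] [|k] //=. Qed.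

Lemma vecE s : vec K s = vecZ K (map Z.of_nat s).
Proof. by apply/rowP => k; rewrite !mxE nth_of_nat ofZ_nat. Qed.

Lemma v_quiverE P : v_quiver K P = vecZ K (map Z.of_nat (quiver_coords P)).
Proof.
(* The remaining words are not partial quivers: both sides are 0. *)
have junk : vecZ K (map Z.of_nat [::]) = 0.
  by apply/rowP => k; rewrite !mxE nth_nil (ofZ_nat K 0).
by case: P => -[[] []] [] /=; rewrite ?vecE // junk.
Qed.

Lemma v_commonE : v_common K = map (vecZ K) common_points.
Proof. by rewrite /v_common !vecE. Qed.

Lemma vectors_ofE i : reduced_w0 i ->
  vectors_of K i = range (generator K (nf i)).
Proof.
move=> red_i; have ok := allP classes_ok _ (nf_class red_i).
have [sz _ _ _ _] := points_shape ok.
have vectorsP v : vectors_of K i v <-> v \in map (vecZ K) (points (nf i)).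
  rewrite map_cat mem_cat -v_commonE /quiver_points quivers_in_nf //.
  split=> [[[P iP <-]|/= ->]|/orP[/mapP[p /mapP[P iP ->] ->]|?]]; last by right.
  - by rewrite v_quiverE; apply/orP; left; apply/map_f/map_f/mem_quivers_in.
  - by rewrite orbT.
  - by left; exists P; [exact/mem_quivers_in | exact: v_quiverE].
apply/seteqP; split=> [v /vectorsP/(nthP 0)[k]|_ [k _ <-]].
  rewrite size_map sz => k10 <-; exists (Ordinal k10) => //.
  by rewrite (nth_map [::]) ?sz.
by apply/vectorsP; apply: (map_f (vecZ K)); rewrite mem_nth // sz.
Qed.

Lemma ev_sum_ge0 h (s : seq (seq Z)) :
  (forall g, g \in s -> 0 <= ev h (coords (vecZ K g))) ->
  0 <= ev h (coords (vecZ K (foldr addf [::] s))).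
Proof.
elim: s => [_|g s IH s0] /=.
  rewrite (_ : vecZ K [::] = 0) ?ev_coords0 //.
  by apply/rowP => k; rewrite !mxE nth_nil (ofZ_nat K 0).
rewrite vecZD ev_coordsD; apply: addr_ge0; first by rewrite s0 ?mem_head.
apply: IH => g' g'_in.
by rewrite s0 // inE g'_in orbT.
Qed.

Definition simplicial_of (i : seq nat) : set 'rV[K]_10 :=
  cell_set (pattern_of (nf i)) `&` nonneg_orthant K.

Lemma walls_simplicial_of i : reduced_w0 i ->
  walls (simplicial_of i) = range (opposite (generator_mx K (nf i))).
Proof.
move=> red_i; have ok := allP classes_ok _ (nf_class red_i).
rewrite /simplicial_of (cell_orthant_cone K ok) walls_cone //.
exact: unit_generator_mx.
Qed.

Lemma simplicial_simplicial_of i :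
  reduced_w0 i -> simplicial_region (simplicial_of i).
Proof.
move=> red_i; apply: simplicial_class.
exact: (allP classes_ok _ (nf_class red_i)).
Qed.

(** The sum of the generators is an interior point of the cell, and determines
the sign pattern, which in turn determines the class. *)
Lemma simplicial_of_inj i i' : reduced_w0 i -> reduced_w0 i' ->
  simplicial_of i = simplicial_of i' -> nf i = nf i'.
Proof.
move=> red_i red_i' eqX; have ci := nf_class red_i; have ci' := nf_class red_i'.
have ok := allP classes_ok _ ci; have ok' := allP classes_ok _ ci'.
pose p := vecZ K (center (nf i)).
have p_open : open_cell (pattern_of (nf i)) p := center_open_cell K ok.
have p_in : simplicial_of i p.
  split; first exact: open_cell_sub.
  apply/nonneg_orthantE/allP => h h_unit; apply: ev_sum_ge0 => g g_in.
  have [sz _ _ _ _] := points_shape ok.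
  have [k k10 <-] := nthP [::] g_in; rewrite sz in k10.
  exact: (unit_form_generator_ge0 K ok (Ordinal k10)).
rewrite eqX in p_in; case: p_in => p_cell' _.
have : pattern_of (nf i') = pattern_of (nf i).
  by apply: (cell_pos_inj (st := steps) _ _ p_open p_cell'); rewrite !size_walk.
by move=> e; apply: (uniq_map_inj pattern_of_inj_classes).
Qed.

Lemma region_six_inequalities (X : set 'rV[K]_10) (A : 'M[K]_(10, 6)) :
  region_of_linearity X -> defined_by X A ->
  exists2 w, w \in classes & X = cell_set (pattern_of w).
Proof.
move=> /region_feasible[sg f_sg XE] XA.
have := allP feasible_covered _ f_sg.
case: ifP => [/mapP[w cw eq_sg] _|_ /mapP[c hc eq_c]].
  exists w => //; rewrite XE eq_sg.
  exact: (closure_chart_class K (allP classes_ok _ cw)).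
have ok := allP heptads_ok _ hc; rewrite eq_c in XE.
by case: (heptad_not6 ok XE XA).
Qed.

Lemma simplicial_regionE S : simplicial_region S ->
  exists2 i, reduced_w0 i & simplicial_of i = S.
Proof.
move=> [X [regX [A XA _] ->]].
have [w cw ->] := region_six_inequalities regX XA.
by exists w; [exact: class_reduced | rewrite /simplicial_of nf_fixed].
Qed.

Lemma row_generator_mx w k : row k (generator_mx K w) = generator K w k.
Proof. exact: rowK. Qed.

End Main.

Local Open Scope ring_scope.
Local Open Scope classical_set_scope.

Theorem proposition5p1 (K : realType) :
  exists X : seq nat -> set 'rV[K]_10,
    [/\ forall i : seq nat, reduced_w0 i ->
          [/\ (vectors_of K i #= `I_10)%card,
              forall u : 'rV[K]_10, vectors_of K i u ->
                exists! W : {vspace 'rV[K]_10}, wall_opposite i u W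
            & [/\ (walls_of K i #= `I_10)%card,
                  simplicial_region (X i),
                  walls (X i) = walls_of K i
                & vectors_of K i `<=` X i]],
        forall i i' : seq nat, reduced_w0 i -> reduced_w0 i' ->
          (X i = X i' <-> same_commutation_class i i')
      & forall S : set 'rV[K]_10, simplicial_region S ->
          exists2 i : seq nat, reduced_w0 i & X i = S].
Proof.
exists (@simplicial_of K); split; last exact: simplicial_regionE.
  move=> i red_i; have ok := allP classes_ok _ (nf_class red_i).
  set G := generator_mx K (nf i).
  have unitG : G \in unitmx := unit_generator_mx K ok.
  have vectorsE : vectors_of K i = range (fun k => row k G).
    rewrite vectors_ofE //; congr image; apply/funext => k.
    by rewrite row_generator_mx.
  have row_inj : injective (fun k => row k G).
    move=> k l e; apply/eqP/contraT => kl.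
    have := coordinate_row unitG l k.
    by rewrite e coordinate_row // eqxx (negbTE kl) => /eqP; rewrite oner_eq0.
  have wallsE := walls_simplicial_of K red_i; rewrite -/G in wallsE.
  have wall_oppositeP k W : wall_opposite i (row k G) W <-> W = opposite G k.
    rewrite /wall_opposite vectorsE; split=> [[[S _ [dimW _]] onW]|->].
      apply/esym/opposite_unique => // l lk; apply: onW.
      split; first by exists l.
      by move=> /row_inj/eqP; rewrite (negbTE lk).
    split.
      exists (simplicial_of i); first exact: simplicial_simplicial_of.
      by rewrite wallsE; exists k.
    move=> _ [[l _ <-] lk]; rewrite row_opposite //.
    by apply/eqP => e; apply: lk; rewrite /= e.
  have walls_ofE : walls_of K i = range (opposite G).
    apply/seteqP; split=> [W [u]|_ [k _ <-]].
      by rewrite vectorsE => -[k _ <-] /wall_oppositeP ->; exists k.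
    exists (row k G); last exact/wall_oppositeP.
    by rewrite vectorsE; exists k.
  split.
  - by rewrite vectorsE; exact: card_range_ord.
  - move=> u; rewrite vectorsE => -[k _ <-]; exists (opposite G k); split.
      exact/wall_oppositeP.
    by move=> W /wall_oppositeP.
  - split; rewrite ?walls_ofE //; first by apply/card_range_ord/opposite_inj.
      exact: simplicial_simplicial_of.
    rewrite vectorsE /simplicial_of (cell_orthant_cone K ok) => _ [k _ <-].
    exact: row_cone.
move=> i i' red_i red_i'; split=> [|/same_classP e]; last first.
  by rewrite /simplicial_of e.
by move=> /(simplicial_of_inj red_i red_i') /same_classP.
Qed.
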